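(* For all $1\le p<q<\infty$ there are positive constants $c=c(p,q)$, $C=C(p,q)$ and $T=T(p,q)$ such that if $\mu$ denotes the normalized Lebesgue measure on the positive quadrant of the unit sphere of $L_p^n$, then $$\mu(\|u\|_{L_q^n}>t)\le \exp(-c\,t^p n^{p/q})\tag{1}$$ for all $t>T$, and $$\mu(\|u\|_{L_q^n}>t)\ge \exp(-C\,t^p n^{p/q})\tag{2}$$ for all $2\le t\le \tfrac12 n^{\frac1p-\frac1q}$. Moreover, for $q>2p$ (or any other universal positive multiple of $p$), one can take $c(p,q)=\frac{\gamma}{p}$, $C(p,q)=\frac{\Gamma}{p}$ and $T(p,q)=\tau\min\{q,\log n\}^{1/p}\le \tau q^{1/p}$. Here $\gamma$, $\Gamma$ and $\tau$ are universal positive constants.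
   Context: For $0<r<\infty$ and $u=(u_1,\dots,u_n)\in\mathbb{R}^n$, $\|u\|_{L_r^n}=\bigl(n^{-1}\sum_{i=1}^n|u_i|^r\bigr)^{1/r}$. The positive quadrant of the unit sphere of $L_p^n$ is the set $\{u\in\mathbb{R}^n: u_i\ge 0 \text{ for all } i,\ \|u\|_{L_p^n}=1\}$; it is equipped with the $(n-1)$-dimensional normalized Lebesgue measure $\mu$ (total mass one). $\mu(\|u\|_{L_q^n}>t)$ is the $\mu$-measure of the set of points $u$ of this positive quadrant with $\|u\|_{L_q^n}>t$. The constants $c$, $C$ and $T$ in the first part depend on $p$ and $q$ but not on $n$; $\log$ is the natural logarithm.
   Formalization: In the ''moreover'' part n ≥ 2 is assumed: for n = 1 one has log n = 0, hence T = 0, the sphere is a single point of norm 1, and (1) would fail for 0 < t < 1. *)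

(* Defs.v *)
From HB Require Import structures.
From mathcomp Require Import all_boot all_order all_algebra.
From mathcomp Require Import all_classical all_reals all_analysis.
Set Implicit Arguments.
Unset Strict Implicit.
Unset Printing Implicit Defensive.
Import Order.TTheory GRing.Theory Num.Theory.
Import numFieldNormedType.Exports.
Local Open Scope classical_set_scope.
Local Open Scope ring_scope.

Section lebesgue_tuple.
Context {R : realType}.
Local Notation mR := (measurableTypeR R).

Definition cons_pair n (z : n.-tuple mR * mR) : n.+1.-tuple mR :=
  [tuple of z.2 :: z.1].

Lemma measurable_cons_pair n : measurable_fun setT (@cons_pair n).
Proof. exact: (measurable_cons measurable_snd measurable_fst). Qed.

(* The n-fold product of the one-dimensional Lebesgue measure; for n = 0 it is
   the unit mass at the only point of R^0. *)
Fixpoint lebesgue_tuple n : set (n.-tuple mR) -> \bar R :=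
  match n with
  | 0 => dirac [tuple]
  | m.+1 => pushforward (lebesgue_tuple (n := m) \x lebesgue_measure)%E
              (@cons_pair m)
  end.

Lemma lebesgue_tuple_is_measure n :
  exists m : {measure set (n.-tuple mR) -> \bar R},
    lebesgue_tuple (n := n) = m.
Proof.
elim: n => [|n [m IH]]; first by exists (dirac [tuple]).
have : exists m' : {measure set (n.+1.-tuple mR) -> \bar R},
    pushforward (m \x lebesgue_measure)%E (@cons_pair n) = m'.
  by unshelve eexists (pushforward (m \x lebesgue_measure)%E (@cons_pair n));
    first exact: measurable_cons_pair.
by rewrite /= IH.
Qed.

Let l0 n : lebesgue_tuple (n := n) set0 = 0%E.
Proof. by have [m ->] := lebesgue_tuple_is_measure n. Qed.

Let l_ge0 n A : (0 <= lebesgue_tuple (n := n) A)%E.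
Proof. by have [m ->] := lebesgue_tuple_is_measure n. Qed.

Let l_sigma n : semi_sigma_additive (lebesgue_tuple (n := n)).
Proof.
have [m ->] := lebesgue_tuple_is_measure n.
exact: measure_semi_sigma_additive.
Qed.

HB.instance Definition _ n := isMeasure.Build _ _ _ (lebesgue_tuple (n := n))
  (@l0 n) (@l_ge0 n) (@l_sigma n).

Lemma lebesgue_tuple_box n (A : 'I_n -> set mR) :
  (forall i, measurable (A i)) ->
  lebesgue_tuple (n := n) [set y | forall i, A i (tnth y i)] =
  (\prod_i lebesgue_measure (A i))%E.
Proof.
elim: n A => [|n IH] A mA.
  rewrite big_ord0 /= /dirac indicE mem_set//.
  by case.
rewrite big_ord_recl /= /pushforward.
rewrite (_ : _ @^-1` _ =
    [set y : n.-tuple mR | forall i, A (lift ord0 i) (tnth y i)] `*` A ord0); last first.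
  apply/seteqP; split => [[y x] /= h|[y x] /= [h h0] i].
    by split => [i|]; [have := h (lift ord0 i)|have := h ord0];
      rewrite /cons_pair /= ?tnthS.
  by case: (unliftP ord0 i) => [j|] ->; rewrite /cons_pair /= ?tnthS.
rewrite product_measure1E//.
  by rewrite muleC; congr (_ * _)%E; apply: IH.
have -> : [set y : n.-tuple mR | forall i, A (lift ord0 i) (tnth y i)] =
    \bigcap_(i in [set: 'I_n]) ((fun y => tnth y i) @^-1` A (lift ord0 i)).
  by apply/seteqP; split => y /= h i => [_|]; apply: h.
apply: fin_bigcap_measurable; first exact: finite_finset.
move=> i _; rewrite -[X in measurable X]setTI.
exact: (measurable_tnth i measurableT (mA _)).
Qed.
End lebesgue_tuple.

Section Lrn_sphere.
Context {R : realType}.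

Definition Lrn_norm n (r : R) (u : n.-tuple R) : R :=
  (n%:R^-1 * \sum_(i < n) `|tnth u i| `^ r) `^ r^-1.

Definition Lpn_quadrant n (p : R) : set (n.-tuple R) :=
  [set u | (forall i, 0 <= tnth u i) /\ Lrn_norm p u = 1].

Definition partial n (f : n.-tuple R -> R) (i : 'I_n) (y : n.-tuple R) : R :=
  derive1 (fun s => f [tuple if j == i then s else tnth y j | j < n]) (tnth y i).

Definition graph_point n (f : n.-tuple R -> R) (y : n.-tuple R) :
    n.+1.-tuple R :=
  [tuple of rcons y (f y)].

(* n-dimensional surface area of the part of A lying on the graph of f above D,
   D being open and f continuously differentiable on D. *)
Definition graph_area n (D : set (n.-tuple R)) (f : n.-tuple R -> R)
    (A : set (n.+1.-tuple R)) : \bar R :=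
  (\int[@lebesgue_tuple R n]_(y in D `&` graph_point f @^-1` A)
     (Num.sqrt (1 + \sum_(i < n) partial f i y ^+ 2))%:E)%E.

Definition quadrant_dom n (p : R) : set (n.-tuple R) :=
  [set y | (forall i, 0 < tnth y i) /\ \sum_(i < n) tnth y i `^ p < n.+1%:R].

Definition quadrant_fun n (p : R) (y : n.-tuple R) : R :=
  (n.+1%:R - \sum_(i < n) tnth y i `^ p) `^ p^-1.

Let tnth_graph_pointl n (f : n.-tuple R -> R) y (i : 'I_n) :
  tnth (graph_point f y) (widen_ord (leqnSn n) i) = tnth y i.
Proof. by rewrite !(tnth_nth 0) /= nth_rcons size_tuple ltn_ord. Qed.

Let tnth_graph_pointr n (f : n.-tuple R -> R) y :
  tnth (graph_point f y) ord_max = f y.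
Proof. by rewrite (tnth_nth 0) /= nth_rcons size_tuple ltnn eqxx. Qed.

Let Lrn_norm_eq1 n (p : R) (u : n.+1.-tuple R) : 0 < p ->
  (forall i, 0 <= tnth u i) ->
  (Lrn_norm p u = 1) <-> (\sum_(i < n.+1) tnth u i `^ p = n.+1%:R).
Proof.
move=> p0 u0; rewrite /Lrn_norm.
rewrite (eq_bigr (fun i => tnth u i `^ p)); last by move=> i _; rewrite ger0_norm.
have S0 : 0 <= \sum_(i < n.+1) tnth u i `^ p.
  by apply: sumr_ge0 => i _; exact: powR_ge0.
split=> [h|->]; last by rewrite mulVf ?pnatr_eq0// powR1.
have : (n.+1%:R^-1 * \sum_(i < n.+1) tnth u i `^ p) `^ p^-1 `^ p = 1.
  by rewrite h powR1.
rewrite -powRrM mulVf ?gt_eqF// powRr1 ?mulr_ge0 ?invr_ge0// => {}h.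
by apply: (@mulfI _ n.+1%:R^-1); rewrite ?invr_eq0 ?pnatr_eq0// mulVf ?pnatr_eq0.
Qed.

(* The positive quadrant of the unit sphere of L_p^(n+1), without its relative
   boundary (where some coordinate vanishes), which is negligible for the
   n-dimensional Lebesgue measure, is a graph. *)
Lemma quadrant_graph n (p : R) : 0 < p ->
  [set u | Lpn_quadrant p u /\ forall i, 0 < tnth u i] =
  graph_point (quadrant_fun p) @` @quadrant_dom n p.
Proof.
move=> p0; apply/seteqP; split => [u [[u0 u1] upos]|_ [y [y0 y1] <-]].
  move/Lrn_norm_eq1 : u1 => /(_ p0 u0); rewrite big_ord_recr /= => u1.
  pose y := [tuple tnth u (widen_ord (leqnSn n) i) | i < n].
  have Sy : \sum_(i < n) tnth y i `^ p = n.+1%:R - tnth u ord_max `^ p.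
    by rewrite -u1 addrK; apply: eq_bigr => i _; rewrite tnth_mktuple.
  exists y.
    split=> [i|]; first by rewrite tnth_mktuple.
    by rewrite Sy ltrBlDr ltrDl powR_gt0.
  have fy : quadrant_fun p y = tnth u ord_max.
    rewrite /quadrant_fun Sy opprB addrC subrK -powRrM mulfV ?gt_eqF//.
    by rewrite powRr1.
  apply: eq_from_tnth => i.
  have [->|in_] := eqVneq i ord_max; first by rewrite tnth_graph_pointr.
  have lin : (i < n)%N by rewrite ltn_neqAle -ltnS ltn_ord andbT.
  rewrite (_ : i = widen_ord (leqnSn n) (Ordinal lin)); last exact: val_inj.
  by rewrite tnth_graph_pointl tnth_mktuple.
have fy0 : 0 < quadrant_fun p y by rewrite powR_gt0// subr_gt0.
have pos i : 0 < tnth (graph_point (quadrant_fun p) y) i.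
  have [->|in_] := eqVneq i ord_max; first by rewrite tnth_graph_pointr.
  have lin : (i < n)%N by rewrite ltn_neqAle -ltnS ltn_ord andbT.
  rewrite (_ : i = widen_ord (leqnSn n) (Ordinal lin)); last exact: val_inj.
  by rewrite tnth_graph_pointl.
have pos' i := ltW (pos i).
split=> //; split=> //; apply/Lrn_norm_eq1 => //.
rewrite big_ord_recr /= tnth_graph_pointr.
under eq_bigr do rewrite tnth_graph_pointl.
rewrite -powRrM mulVf ?gt_eqF// powRr1; first by rewrite addrC subrK.
by rewrite ltW// subr_gt0.
Qed.

(* The normalized n-dimensional Lebesgue measure (surface area) on the positive
   quadrant of the unit sphere of L_p^(n+1). *)
Definition quadrant_measure n (p : R) (A : set (n.+1.-tuple R)) : R :=
  let area := graph_area (@quadrant_dom n p) (quadrant_fun p) in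
  fine (area A) / fine (area setT).

Definition quadrant_tail n (p q t : R) : R :=
  quadrant_measure p
    [set u : n.+1.-tuple R | Lpn_quadrant p u /\ t < Lrn_norm q u].

End Lrn_sphere.

(* Main.v *)
Require Import Defs.
From HB Require Import structures.
From mathcomp Require Import all_boot all_order all_algebra.
From mathcomp Require Import all_classical all_reals all_analysis.
From mathcomp Require Import measurable_realfun lra ring.
Set Implicit Arguments.
Unset Strict Implicit.
Unset Printing Implicit Defensive.
Import Order.TTheory GRing.Theory Num.Theory.
Import numFieldNormedType.Exports.
Local Open Scope classical_set_scope.
Local Open Scope ring_scope.

(** Write N for the dimension of the ambient space, v_i = u_i^p and
s = t^p N^(p/q).  On the sphere the v_i are nonnegative with sum N, and
||u||_q > t means that the sum of the v_i^(q/p) exceeds (t^p)^(q/p) N.  The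
v_i behave like independent variables with tails exp(-x/p) conditioned to have
sum N, and the cheapest way to a large q-norm is one coordinate v_i above s, at
the price exp(-s/p).

Surface measure enters only through its slices at a fixed first coordinate x.
Since sqrt(A + b^2) <= sqrt A + b, the area element of the sphere is at least
the area element of the slice, and exceeds it by at most the slope in the
direction of x; integrated along x first, this slope gives the volume of the
projection, which is at most the area.  So the area in dimension n + 1 lies
between the integral of the areas of its n-dimensional slices and twice that
integral (area_step_ge, area_step_le), and the slices are dilates of one another
(area_scale).

Lower bound (quadrant_tail_ge).  The cap where the first coordinate exceeds
t N^(1/q) is contained in the event.  By the slicing, the ratio of its measure
to the total is, up to the factor 2, a ratio of integrals of (N - x^p)^(m/p) in
the single variable x, whatever the dimension.

Upper bound (quadrant_tail_le).  If every set A of coordinates satisfies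
sum_(i in A) v_i <= s/4 + 8p sum_(k < |A|) log(eN/(k+1)), then v is weakly
majorized by a sequence whose (q/p)-th power sum is too small for the event
(large_subset_sum).  Otherwise some A violates this, and a union bound with
exponential moments of the subset sums applies.  The moments come from the same
slicing, by induction on the dimension (weighted_area_le), which compares the
surface measure with a product measure; the terms log(eN/(k+1)) pay for the
number of subsets (sum_subsets_profile_le).  The normalizing constant is bounded
below by cutting the product measure into shells, which are dilates of one body
(mass_le_area).  All this loses a factor polynomial in N
(quadrant_tail_le_factor), which is smaller than exp(s/(16p)): t > T forces s/p
to be a large multiple of p log N.

Both bounds hold with constants that are universal over 1 <= p < q, so that the
two parts of the theorem are instances of them; dimension one, where
log N = 0, is quadrant_tail_dim1. *)

(** * Integration over tuples, one coordinate at a time *)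
Section nonneg_integral.
Local Open Scope ereal_scope.
Context d (T : measurableType d) (R : realType).
Variable mu : {measure set T -> \bar R}.
Implicit Types (A B D : set T) (f g : T -> \bar R).

(** The integral of a nonnegative function is a supremum over the simple
functions below it, hence monotone; this is how iterated integrals over slices
are compared. *)
Lemma nonneg_le_integral D f g :
  (forall x, D x -> 0 <= f x) -> (forall x, D x -> f x <= g x) ->
  \int[mu]_(x in D) f x <= \int[mu]_(x in D) g x.
Proof.
move=> f0 fg; rewrite (integral_mkcond D f) (integral_mkcond D g).
have F0 x : 0 <= (f \_ D) x by apply: erestrict_ge0.
have FG x : (f \_ D) x <= (g \_ D) x by apply: lee_restrict.
rewrite !ge0_integralTE//; last by move=> x; exact: le_trans (F0 x) (FG x).
by apply: le_ereal_sup => _ [h hf <-]; exists h => // x; exact: le_trans (FG x).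
Qed.

Lemma nonneg_subset_integral A B f :
  (forall x, B x -> 0 <= f x) -> A `<=` B ->
  \int[mu]_(x in A) f x <= \int[mu]_(x in B) f x.
Proof.
move=> f0 AB; rewrite (integral_mkcond A f) (integral_mkcond B f).
apply: nonneg_le_integral => x _; first by apply: erestrict_ge0 => y /AB /f0.
by apply: restrict_lee.
Qed.

(** The form used for slices of different bodies, which need not be nested. *)
Lemma nonneg_le_integral_dom A B f g :
  (forall x, A x -> 0 <= f x) -> (forall x, B x -> 0 <= g x) ->
  (forall x, A x -> B x -> f x <= g x) -> (forall x, A x -> ~ B x -> f x <= 0) ->
  \int[mu]_(x in A) f x <= \int[mu]_(x in B) g x.
Proof.
move=> f0 g0 fg fN; rewrite (integral_mkcond A f) (integral_mkcond B g).
apply: nonneg_le_integral => x _; first exact: erestrict_ge0.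
rewrite !patchE; case: ifPn => [|_]; last first.
  by case: ifPn => //; rewrite inE => /g0.
by rewrite inE => Ax; case: ifPn; rewrite ?inE ?notin_setE => Bx; [exact: fg|exact: fN].
Qed.
End nonneg_integral.

Section dilation.
Context {R : realType}.
Local Notation mu := (@lebesgue_measure R).
Local Open Scope ereal_scope.

Let dil (c : R) : measurableTypeR R -> measurableTypeR R := fun x => (c * x)%R.

Let measurable_dil c : measurable_fun setT (dil c).
Proof. exact: measurable_funM. Qed.

Let dilated_measure (c : R) :
  exists m : {measure set (measurableTypeR R) -> \bar R},
    pushforward mu (dil c) = m.
Proof.
by unshelve eexists (pushforward mu (dil c)); first exact: measurable_dil.
Qed.

(** Multiplied by c, the image of Lebesgue measure under x -> c x agrees with
Lebesgue measure on half-open intervals, hence everywhere. *)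
Lemma ge0_integral_dilation (c : R) (f : R -> \bar R) : (0 < c)%R ->
  measurable_fun setT f -> (forall x, 0 <= f x) ->
  \int[mu]_x f x = c%:E * \int[mu]_x f (c * x)%R.
Proof.
move=> c0 mf f0.
have [m mE] := dilated_measure c.
transitivity (\int[mscale (NngNum (ltW c0)) m]_x f x).
  apply: eq_measure_integral => A mA _.
  apply: lebesgue_measure_unique => //= _ [[a b]] _ <- /=.
  rewrite /mscale -mE /pushforward /=.
  rewrite (_ : _ @^-1` _ = `]c^-1 * a, c^-1 * b]%classic)%R; last first.
    by apply/seteqP; split => x /=; rewrite !in_itv/= /dil ltr_pdivrMl// ler_pdivlMl.
  rewrite !lebesgue_measure_itv/= !lte_fin ltr_pM2l ?invr_gt0//.
  case: ifPn => _; last by rewrite mule0.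
  rewrite -!EFinD -EFinM; congr EFin.
  by rewrite mulrBr !mulrA mulfV ?gt_eqF// !mul1r.
rewrite ge0_integral_mscale//= -mE.
rewrite ge0_integral_pushforward//; exact: measurable_dil.
Qed.
End dilation.

Section tuple_tonelli.
Context {R : realType}.
Local Notation mR := (measurableTypeR R).
Local Notation mu := (@lebesgue_measure R).
Local Notation leb n := (@lebesgue_tuple R n).
Local Open Scope ereal_scope.

Lemma measurable_forall_tnth n (A : 'I_n -> set mR) :
  (forall i, measurable (A i)) ->
  measurable [set y : n.-tuple mR | forall i, A i (tnth y i)].
Proof.
move=> mA.
have -> : [set y : n.-tuple mR | forall i, A i (tnth y i)] =
    \bigcap_(i in [set: 'I_n]) ((fun y => tnth y i) @^-1` A i).
  by apply/seteqP; split => y /= h i => [_|]; apply: h.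
apply: fin_bigcap_measurable; first exact: finite_finset.
move=> i _; rewrite -[X in measurable X]setTI.
exact: (measurable_tnth i measurableT (mA _)).
Qed.

(** Exhaustion by cubes. Integrating in the order tail first, head last needs
it. *)
Let lebesgue_tuple_sigma_finite n : sigma_finite setT (leb n).
Proof.
exists (fun k => [set y : n.-tuple mR | forall i, `](- k%:R)%R, k%:R[%classic (tnth y i)]).
  apply/seteqP; split => // y _.
  pose r : R := (\sum_i `|tnth y i|)%R.
  exists (Num.bound r) => // i /=; rewrite in_itv/= -ltr_norml.
  apply: (@le_lt_trans _ _ r).
    by rewrite /r (bigD1 i)//= lerDl sumr_ge0.
  apply: archi_boundP; exact: sumr_ge0.
move=> k; split.
  exact: (measurable_forall_tnth (A := fun=> `](- k%:R)%R, k%:R[%classic)).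
rewrite (@lebesgue_tuple_box R n (fun=> `](- k%:R)%R, k%:R[%classic)); last first.
  by move=> i; exact: measurable_itv.
rewrite (eq_bigr (fun=> ((fine (mu `](- k%:R)%R, k%:R[%classic)))%:E)); last first.
  move=> i _; rewrite fineK// lebesgue_measure_itv/=.
  by case: ifPn.
by rewrite prodEFin ltry.
Qed.

HB.instance Definition _ n := Measure_isSigmaFinite.Build _ _ _ (leb n)
  (lebesgue_tuple_sigma_finite n).

Section tonelli.
Context (n : nat) (F : n.+1.-tuple mR -> \bar R).
Hypotheses (mF : measurable_fun setT F) (F0 : forall y, 0 <= F y).

Let mFc : measurable_fun setT (F \o @cons_pair R n).
Proof. exact: (measurableT_comp mF (@measurable_cons_pair R n)). Qed.

Let tuple_integral_pair :
  \int[leb n.+1]_y F y = \int[leb n \x mu]_z (F \o @cons_pair R n) z.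
Proof.
rewrite /= (ge0_integral_pushforward (@measurable_cons_pair R n))//.
Qed.

Lemma tuple_tonelli_tail :
  \int[leb n.+1]_y F y = \int[leb n]_y \int[mu]_x F (cons_pair (y, x)).
Proof.
rewrite tuple_integral_pair.
exact: (fubini_tonelli1 (F \o @cons_pair R n) mFc (fun=> F0 _)).
Qed.

Lemma tuple_tonelli_head :
  \int[leb n.+1]_y F y = \int[mu]_x \int[leb n]_y F (cons_pair (y, x)).
Proof.
rewrite tuple_integral_pair.
exact: (fubini_tonelli2 (F \o @cons_pair R n) mFc (fun=> F0 _)).
Qed.

Lemma measurable_integral_head :
  measurable_fun setT (fun y => \int[mu]_x F (cons_pair (y, x))).
Proof.
exact: (measurable_fun_fubini_tonelli_F (m2 := mu) (F \o @cons_pair R n)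
  mFc (fun=> F0 _)).
Qed.

End tonelli.
End tuple_tonelli.

Section tuple_dilation.
Context {R : realType}.
Local Notation mR := (measurableTypeR R).
Local Notation leb n := (@lebesgue_tuple R n).
Local Open Scope ereal_scope.

Lemma tnth_cons_pair0 n (y : n.-tuple mR) (x : mR) :
  tnth (cons_pair (y, x)) ord0 = x.
Proof. by []. Qed.

Lemma tnth_cons_pairS n (y : n.-tuple mR) (x : mR) (i : 'I_n) :
  tnth (cons_pair (y, x)) (lift ord0 i) = tnth y i.
Proof. by rewrite /cons_pair /= tnthS. Qed.

Definition dilate n (c : R) (y : n.-tuple mR) : n.-tuple mR :=
  [tuple (c * tnth y i)%R | i < n].

Lemma dilate_cons_pair n (c : R) (y : n.-tuple mR) (x : R) :
  dilate c (cons_pair (y, x)) = cons_pair (dilate c y, (c * x)%R).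
Proof.
apply: eq_from_tnth => i; rewrite tnth_mktuple.
by case: (unliftP ord0 i) => [j|] ->;
  rewrite ?tnth_cons_pairS ?tnth_cons_pair0 ?tnth_mktuple.
Qed.

Lemma measurable_dilate n (c : R) : measurable_fun setT (@dilate n c).
Proof.
apply/measurable_fun_tnthP => i.
rewrite (_ : _ \o _ = (fun y : n.-tuple mR => c * tnth y i)%R); last first.
  by apply/funext => y /=; rewrite tnth_mktuple.
by apply: measurable_funM => //; exact: measurable_tnth.
Qed.

(** The source of all homogeneity properties below: the one-dimensional change
of variables in each coordinate in turn. *)
Lemma ge0_integral_dilate n (c : R) (F : n.-tuple mR -> \bar R) : (0 < c)%R ->
  measurable_fun setT F -> (forall y, 0 <= F y) ->
  \int[leb n]_y F y = (c ^+ n)%:E * \int[leb n]_y F (dilate c y).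
Proof.
move=> c0; elim: n F => [|n IH] F mF F0.
  rewrite expr0 mul1e; apply: eq_integral => y _; congr F.
  by apply: eq_from_tnth; case.
have mFc : measurable_fun setT (F \o @cons_pair R n).
  exact: (measurableT_comp mF (@measurable_cons_pair R n)).
have mFd : measurable_fun setT (F \o @dilate n.+1 c).
  exact: (measurableT_comp mF (@measurable_dilate n.+1 c)).
have mFdc : measurable_fun setT ((F \o @dilate n.+1 c) \o @cons_pair R n).
  exact: (measurableT_comp mFd (@measurable_cons_pair R n)).
rewrite tuple_tonelli_tail// IH//; last 2 first.
- exact: measurable_integral_head.
- by move=> y; apply: integral_ge0 => x _; exact: F0.
rewrite (tuple_tonelli_tail mFd); last by move=> y; exact: F0.
rewrite exprSr EFinM -muleA; congr (_ * _).
rewrite -ge0_integralZl_EFin ?ltW//; last 2 first.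
- by move=> y _; apply: integral_ge0 => x _; exact: F0.
- exact: (measurable_integral_head mFd (fun=> F0 _)).
apply: eq_integral => y _.
rewrite (@ge0_integral_dilation R c (fun x => F (cons_pair (dilate c y, x))))//.
  by congr (_ * _); apply: eq_integral => x _ /=; rewrite dilate_cons_pair.
exact: (measurableT_comp mFc (pair1_measurable _)).
Qed.

End tuple_dilation.

(** * The projection of the quadrant and its slices *)
Section simplex.
Context {R : realType}.
Local Notation mR := (measurableTypeR R).
Variable p : R.
Implicit Types (n : nat) (M : R).

Definition power_sum n (y : n.-tuple R) : R := \sum_(i < n) tnth y i `^ p.

(** The projection, along the last axis, of the quadrant of the p-sphere where
the p-th powers have sum M. The parameter M is kept free because fixing a
coordinate lowers it. *)
Definition simplex n M : set (n.-tuple R) :=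
  [set y | (forall i, 0 < tnth y i) /\ power_sum y < M].

Lemma power_sum_ge0 n (y : n.-tuple R) : 0 <= power_sum y.
Proof. by apply: sumr_ge0 => i _; exact: powR_ge0. Qed.

Lemma power_sum_cons n (y : n.-tuple mR) (x : R) :
  power_sum (cons_pair (y, x)) = x `^ p + power_sum y.
Proof.
rewrite /power_sum big_ord_recl; congr (_ + _).
by apply: eq_bigr => i _; rewrite tnth_cons_pairS.
Qed.

Lemma simplex_cons n M (y : n.-tuple mR) (x : R) :
  simplex M (cons_pair (y, x)) <-> 0 < x /\ simplex (M - x `^ p) y.
Proof.
rewrite /simplex /= power_sum_cons; split => [[h hM]|[x0 [h hM]]].
  split; first exact: h ord0.
  split=> [i|]; first by have := h (lift ord0 i); rewrite tnth_cons_pairS.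
  by rewrite ltrBrDl.
split=> [i|]; last by rewrite -ltrBrDl.
by case: (unliftP ord0 i) => [j|] ->; rewrite ?tnth_cons_pairS.
Qed.

Lemma simplex_gt0 n M (y : n.-tuple R) : simplex M y -> 0 < M.
Proof. by move=> [_]; apply: le_lt_trans; exact: power_sum_ge0. Qed.

Lemma measurable_tnth_powR n (r : R) (i : 'I_n) :
  measurable_fun setT (fun y : n.-tuple mR => tnth y i `^ r).
Proof. exact: (measurableT_comp (measurable_powR r) (measurable_tnth i)). Qed.

Lemma measurable_power_sum n : measurable_fun setT (fun y : n.-tuple mR => power_sum y).
Proof. by apply: measurable_sum => i; exact: measurable_tnth_powR. Qed.

Lemma measurable_simplex n M : measurable (@simplex n M : set (n.-tuple mR)).
Proof.
rewrite (_ : simplex M = [set y : n.-tuple mR | forall i, `]0, +oo[%classic (tnth y i)]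
    `&` (fun y : n.-tuple mR => power_sum y) @^-1` `]-oo, M[%classic); last first.
  apply/seteqP; split => y /=.
    by move=> [h1 h2]; rewrite in_itv/=; split => // i; rewrite in_itv/= andbT.
  rewrite in_itv/= => -[h1 h2]; split => // i.
  by have := h1 i; rewrite in_itv/= andbT.
apply: measurableI.
  exact: (measurable_forall_tnth (A := fun=> `]0, +oo[%classic)).
by rewrite -[X in measurable X]setTI; exact: measurable_power_sum.
Qed.
End simplex.

Section simplex_tonelli.
Context {R : realType}.
Local Notation mR := (measurableTypeR R).
Local Notation mu := (@lebesgue_measure R).
Local Notation leb n := (@lebesgue_tuple R n).
Variable p : R.
Hypothesis p0 : 0 < p.
Local Notation psum := (power_sum p).
Local Notation simplex := (simplex p).

(** With simplex_cons this gives the two orders of integration: over the slice at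
a fixed head, or over the fibre of heads above a fixed tail. *)
Lemma simplex_consE n M (y : n.-tuple mR) (x : R) :
  simplex M (cons_pair (y, x)) <->
  simplex M y /\ 0 < x /\ x < (M - psum y) `^ p^-1.
Proof.
rewrite simplex_cons; split.
  move=> [x0 [hy hM]]; split.
    split => //; apply: lt_le_trans hM _.
    by rewrite gerBl powR_ge0.
  split => //.
  rewrite -[ltLHS](@powRr1 _ x) ?ltW// -(mulfV (lt0r_neq0 p0)) powRrM.
  rewrite gt0_ltr_powR ?invr_gt0// ?nnegrE ?powR_ge0//.
    by rewrite subr_ge0 ltW// (lt_le_trans hM)// gerBl powR_ge0.
  by rewrite ltrBrDr addrC -ltrBrDr.
move=> [[hy hM] [x0 hx]]; split => //; split => //.
rewrite ltrBrDr addrC -ltrBrDr.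
have : x `^ p < ((M - psum y) `^ p^-1) `^ p.
  by rewrite gt0_ltr_powR// nnegrE ?powR_ge0// ltW.
by rewrite -powRrM mulVf ?gt_eqF// powRr1// subr_ge0 ltW.
Qed.

Local Open Scope ereal_scope.

Section tonelli.
Context n (M : R) (F : n.+1.-tuple mR -> \bar R).
Hypotheses (mF : measurable_fun setT F) (F0 : forall y, 0 <= F y).

(** The threshold s cuts off the cap of points with a large first coordinate. *)
Lemma simplex_tonelli_headS (s : R) : (0 <= s)%R ->
  \int[leb n.+1]_(y in [set y | simplex M y /\ (s < tnth y ord0)%R]) F y =
  \int[mu]_(x in `]s, +oo[)
    \int[leb n]_(y in simplex (M - x `^ p)%R) F (cons_pair (y, x)).
Proof.
move=> s0; set D := (X in \int[_]_(y in X) _).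
have mD : measurable (D : set (n.+1.-tuple mR)).
  rewrite (_ : D = simplex M `&` (fun y : n.+1.-tuple mR => tnth y ord0) @^-1`
     `]s, +oo[%classic); last first.
    by apply/seteqP; split => y /=; rewrite in_itv/= andbT.
  apply: measurableI; first exact: measurable_simplex.
  by rewrite -[X in measurable X]setTI; exact: measurable_tnth.
rewrite integral_mkcond tuple_tonelli_head; last 2 first.
- by apply/(measurable_restrictT F mD); exact: measurable_funTS.
- by move=> y; apply: erestrict_ge0.
rewrite [RHS]integral_mkcond; apply: eq_integral => x _.
rewrite patchE; case: ifPn => [|/negP]; rewrite inE /= in_itv/= andbT => sx.
  rewrite [RHS]integral_mkcond; apply: eq_integral => y _; rewrite !patchE.
  congr (if _ then _ else _); apply/idP/idP; rewrite !inE.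
    by move=> [/simplex_cons[]].
  by move=> h; split => //; apply/simplex_cons; split => //; exact: le_lt_trans sx.
apply: integral0_eq => y _; rewrite patchE; case: ifPn => //.
by rewrite inE => -[_]; rewrite tnth_cons_pair0.
Qed.

Lemma simplex_tonelli_head :
  \int[leb n.+1]_(y in simplex M) F y =
  \int[mu]_(x in `]0%R, +oo[)
    \int[leb n]_(y in simplex (M - x `^ p)%R) F (cons_pair (y, x)).
Proof.
rewrite -simplex_tonelli_headS//; congr (integral _ _ _).
by apply/seteqP; split => y /= => [h|[]//]; split => //; exact: h.1.
Qed.

Lemma simplex_tonelli_tail :
  \int[leb n.+1]_(y in simplex M) F y =
  \int[leb n]_(y in simplex M)
    \int[mu]_(x in `]0%R, ((M - psum y) `^ p^-1)%R[) F (cons_pair (y, x)).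
Proof.
have mD := @measurable_simplex R p n.+1 M.
rewrite integral_mkcond tuple_tonelli_tail; last 2 first.
- by apply/(measurable_restrictT F mD); exact: measurable_funTS.
- by move=> y; apply: erestrict_ge0.
rewrite [RHS]integral_mkcond; apply: eq_integral => y _.
rewrite patchE; case: ifPn => [|/negP]; rewrite inE => hy.
  rewrite [RHS]integral_mkcond; apply: eq_integral => x _; rewrite !patchE.
  congr (if _ then _ else _); apply/idP/idP; rewrite !inE /= in_itv/=.
    by move/simplex_consE => [_ [-> ->]].
  by move=> /andP[h1 h2]; apply/simplex_consE.
apply: integral0_eq => x _; rewrite patchE; case: ifPn => //.
by rewrite inE => /simplex_consE[].
Qed.
End tonelli.

Let bpow (M : R) : (0 < M)%R -> ((M `^ p^-1) `^ p)%R = M.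
Proof. by move=> M0; rewrite -powRrM mulVf ?gt_eqF// powRr1// ltW. Qed.

Lemma is_derive_quadrant (M x : R) : (0 < x)%R -> (x `^ p < M)%R ->
  is_derive x 1%R (fun x => (M - x `^ p) `^ p^-1)%R
    (- (x `^ (p - 1) * (M - x `^ p) `^ (p^-1 - 1)))%R.
Proof.
move=> x0 xM.
have dp := is_derive1_powR p x0.
have h0 : (0 < M - x `^ p)%R by rewrite subr_gt0.
have dq := is_derive1_powR p^-1 h0.
apply: is_derive_eq.
  apply: (@is_derive1_comp _ (fun z => z `^ p^-1)%R (fun x => M - x `^ p)%R).
by rewrite add0r mul1r; field; rewrite gt_eqF.
Qed.

Let continuous_powR_at (r x : R) : (0 < x)%R -> {for x, continuous (fun z : R => z `^ r)%R}.
Proof.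
move=> x0; apply: differentiable_continuous; apply/derivable1_diffP.
by apply: derivable_powR; rewrite in_itv/= x0.
Qed.

Let quadrant_weight (M : R) (x : R) : R := (x `^ (p - 1) * (M - x `^ p) `^ (p^-1 - 1))%R.

Let measurable_weight (M : R) : measurable_fun setT (quadrant_weight M).
Proof.
apply: measurable_funM; first exact: measurable_powR.
apply: (measurableT_comp (measurable_powR _)).
by apply: measurable_funB => //; exact: measurable_powR.
Qed.

Let inner (M x : R) : (0 < x)%R -> (x < M `^ p^-1)%R -> (0 < M)%R -> (x `^ p < M)%R.
Proof.
move=> x0 xM M0; rewrite -(bpow M0) gt0_ltr_powR// nnegrE ?powR_ge0//.
exact: ltW.
Qed.

Let integral_weight_cc (M a b : R) : (0 < M)%R -> (0 < a)%R -> (a < b)%R ->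
  (b < M `^ p^-1)%R ->
  \int[mu]_(x in `[a, b]) (quadrant_weight M x)%:E <= (M `^ p^-1)%:E.
Proof.
move=> M0 a0 ab bM.
have inab x : x \in `[a, b]%R -> (0 < x)%R /\ (x `^ p < M)%R.
  rewrite in_itv/= => /andP[ax xb]; have x0 := lt_le_trans a0 ax.
  by split => //; apply: inner => //; exact: le_lt_trans bM.
pose F := fun x => (- ((M - x `^ p) `^ p^-1))%R.
have dF x : x \in `[a, b]%R -> is_derive x 1%R F (quadrant_weight M x).
  move=> /inab[x0 xM]; rewrite -[quadrant_weight M x]opprK.
  by apply: is_deriveN; exact: is_derive_quadrant.
have cF x : x \in `[a, b]%R -> {for x, continuous F}.
  move=> /dF dx; apply: differentiable_continuous; apply/derivable1_diffP.
  exact: ex_derive.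
have ainab : a \in `[a, b]%R by rewrite in_itv/= lexx ltW.
have binab : b \in `[a, b]%R by rewrite in_itv/= lexx ltW.
rewrite (@continuous_FTC2 _ _ F)//; last 3 first.
- apply: continuous_in_subspaceT => x; rewrite inE/= => /inab[x0 xM].
  apply: cvgM; first exact: continuous_powR_at.
  apply: (@continuous_comp _ _ _ (fun x => M - x `^ p)%R (fun z => z `^ (p^-1 - 1))%R).
    by apply: cvgB; [exact: cvg_cst|exact: continuous_powR_at].
  by apply: continuous_powR_at; rewrite subr_gt0.
- split.
  + move=> x /subset_itv_oo_cc /dF dx; exact: ex_derive.
  + by apply: cvg_at_right_filter; exact: cF.
  + by apply: cvg_at_left_filter; exact: cF.
- move=> x /subset_itv_oo_cc /dF dx; rewrite derive1E; exact: derive_val.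
rewrite -EFinB lee_fin /F opprK addrC lerBlDr.
rewrite (le_trans (_ : _ <= M `^ p^-1)%R) ?lerDl ?powR_ge0//.
have [_ aM] := inab _ ainab.
by rewrite ge0_ler_powR ?invr_ge0 ?nnegrE ?subr_ge0 ?gerBl ?powR_ge0
  ?(ltW p0) ?(ltW M0) ?(ltW aM).
Qed.

(** The integrand is minus the derivative of x -> (M - x^p)^(1/p), which decreases
from M^(1/p) to 0. It may be unbounded at both ends, hence the exhaustion by
compact intervals. *)
Lemma integral_quadrant_weight_le (M : R) : (0 < M)%R ->
  \int[mu]_(x in `]0%R, (M `^ p^-1)%R[)
     (x `^ (p - 1) * (M - x `^ p) `^ (p^-1 - 1))%:E <= (M `^ p^-1)%:E.
Proof.
move=> M0; set B := (M `^ p^-1)%R.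
have B0 : (0 < B)%R by rewrite powR_gt0.
(* With k + 3 all the intervals [e k, B - e k] have nonempty interior. *)
pose e (k : nat) : R := (B / k.+3%:R)%R.
have e0 k : (0 < e k)%R by rewrite divr_gt0.
have eB k : (e k < B - e k)%R.
  rewrite -subr_gt0 -addrA -opprD subr_gt0 /e -mulrDl ltr_pdivrMr//.
  by rewrite -mulr2n -(mulr_natr B 2) ltr_pM2l// ltr_nat.
have -> : `]0%R, B[%classic = \bigcup_k `[e k, (B - e k)%R]%classic.
  apply/seteqP; split => x /=; rewrite in_itv/=.
    move=> /andP[x0 xB].
    have m0 : (0 < Num.min x (B - x))%R by rewrite lt_min x0 subr_gt0.
    exists (Num.bound (B / Num.min x (B - x))%R) => //=; rewrite in_itv/=.
    set k := Num.bound _.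
    have : (e k <= Num.min x (B - x))%R.
      rewrite /e ler_pdivrMr// mulrC -ler_pdivrMr//.
      apply: (@le_trans _ _ k%:R); last by rewrite ler_nat -addn3 leq_addr.
      by apply/ltW/archi_boundP/divr_ge0; exact: ltW.
    by rewrite le_min => /andP[-> /= h]; rewrite lerBrDr addrC -lerBrDr.
  move=> [k _] /=; rewrite in_itv/= => /andP[h1 h2].
  by rewrite (lt_le_trans (e0 k) h1)/= (le_lt_trans h2)// gtrBl.
have nd : nondecreasing_seq (fun k => `[e k, (B - e k)%R]%classic).
  move=> i j ij; apply/subsetPset => x /=; rewrite !in_itv/= => /andP[h1 h2].
  have eij : (e j <= e i)%R by rewrite /e ler_pM2l// lef_pV2 ?posrE// ler_nat !ltnS.
  by rewrite (le_trans eij h1)/= (le_trans h2)// lerD2l lerN2.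
have mD k : measurable (`[e k, (B - e k)%R]%classic : set mR) by [].
have mf k : measurable_fun (`[e k, (B - e k)%R]%classic : set mR)
    (fun x => (quadrant_weight M x)%:E).
  by apply: measurable_funTS; apply/measurable_EFinP; exact: measurable_weight.
have f0 k x : `[e k, (B - e k)%R]%classic x -> 0 <= (quadrant_weight M x)%:E.
  by move=> _; rewrite lee_fin mulr_ge0 ?powR_ge0.
rewrite -(cvg_lim _ (ge0_nondecreasing_set_cvg_integral (mu := mu) nd mD mf f0))//.
apply: lime_le.
  apply: ereal_nondecreasing_is_cvgn.
  exact: ge0_nondecreasing_set_nondecreasing_integral.
by apply: nearW => k; apply: integral_weight_cc => //; rewrite -/B gtrBl.
Qed.

End simplex_tonelli.

(** * The area element and its behaviour under slicing *)
Section density.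
Context {R : realType}.
Local Notation mR := (measurableTypeR R).
Local Notation mu := (@lebesgue_measure R).
Local Notation leb n := (@lebesgue_tuple R n).
Variable p : R.
Hypothesis p0 : 0 < p.
Local Notation psum := (power_sum p).
Local Notation simplex := (simplex p).

(** The area element of the graph of y -> (M - sum_i y_i^p)^(1/p). *)
Definition surface_density n (M : R) (y : n.-tuple R) : R :=
  Num.sqrt (1 + \sum_(i < n)
    (tnth y i `^ (p - 1) * (M - psum y) `^ (p^-1 - 1)) ^+ 2).

Lemma partial_quadrant_fun n (y : n.-tuple R) (i : 'I_n) :
  simplex n.+1%:R y ->
  partial (quadrant_fun p) i y =
  - (tnth y i `^ (p - 1) * (n.+1%:R - psum y) `^ (p^-1 - 1)).
Proof.
move=> [y0 yN]; rewrite /partial.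
pose M : R := n.+1%:R - \sum_(j < n | j != i) tnth y j `^ p.
have ME : n.+1%:R - psum y = M - tnth y i `^ p.
  by rewrite /M /psum (bigD1 i)//= opprD addrCA addrC.
rewrite (_ : (fun s => _) = (fun s => (M - s `^ p) `^ p^-1)); last first.
  apply/funext => s; rewrite /quadrant_fun; congr (_ `^ _).
  rewrite (bigD1 i)//= tnth_mktuple eqxx opprD addrCA addrC /M.
  congr (_ - _ - _); apply: eq_bigr => j ji.
  by rewrite tnth_mktuple (negPf ji).
rewrite ME derive1E.
have h : tnth y i `^ p < M by rewrite -subr_gt0 -ME subr_gt0.
have := @is_derive_quadrant R p p0 M (tnth y i) (y0 i) h.
by move=> ?; exact: derive_val.
Qed.

Lemma graph_area_quadrantE n (A : set (n.+1.-tuple R)) :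
  graph_area (@quadrant_dom R n p) (quadrant_fun p) A =
  (\int[leb n]_(y in simplex n.+1%:R `&` graph_point (quadrant_fun p) @^-1` A)
    (surface_density n.+1%:R y)%:E)%E.
Proof.
rewrite /graph_area; apply: eq_integral => y; rewrite inE => -[ys _].
rewrite /surface_density; congr (Num.sqrt (1 + _))%:E; apply: eq_bigr => i _.
by rewrite partial_quadrant_fun// sqrrN.
Qed.

Lemma surface_density_ge1 n (M : R) (y : n.-tuple R) : 1 <= surface_density M y.
Proof.
by rewrite -[leLHS]sqrtr1 ler_wsqrtr// lerDl sumr_ge0// => i _; exact: sqr_ge0.
Qed.

Lemma surface_density_ge0 n (M : R) (y : n.-tuple R) : 0 <= surface_density M y.
Proof. exact: le_trans (surface_density_ge1 M y). Qed.

Lemma measurable_radial n (M r : R) :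
  measurable_fun setT (fun y : n.-tuple mR => (M - psum y) `^ r).
Proof.
apply: (measurableT_comp (measurable_powR _)).
by apply: measurable_funB => //; exact: measurable_power_sum.
Qed.

Lemma measurable_sqrt : measurable_fun setT (@Num.sqrt R).
Proof. by apply: continuous_measurable_fun; exact: sqrt_continuous. Qed.

Lemma measurable_surface_density n (M : R) :
  measurable_fun setT (fun y : n.-tuple mR => surface_density M y).
Proof.
apply: (measurableT_comp measurable_sqrt).
apply: measurable_funD => //; apply: measurable_sum => i.
apply: measurable_funX; apply: measurable_funM; first exact: measurable_tnth_powR.
exact: measurable_radial.
Qed.

(** The area element of the slice through z at the first coordinate of z. *)
Let tail_density n (M : R) (z : n.+1.-tuple R) : R :=
  Num.sqrt (1 + \sum_(i < n)
    (tnth z (lift ord0 i) `^ (p - 1) * (M - psum z) `^ (p^-1 - 1)) ^+ 2).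

(** The slope of the graph, up to sign, in the direction of the first coordinate. *)
Let side_density n (M : R) (z : n.+1.-tuple R) : R :=
  tnth z ord0 `^ (p - 1) * (M - psum z) `^ (p^-1 - 1).

Let tail_density_cons n (M x : R) (y : n.-tuple mR) :
  tail_density M (cons_pair (y, x)) = surface_density (M - x `^ p) y.
Proof.
rewrite /tail_density /surface_density power_sum_cons opprD addrA.
by congr (Num.sqrt (1 + _)); apply: eq_bigr => i _; rewrite tnth_cons_pairS.
Qed.

Let measurable_tail_density n (M : R) :
  measurable_fun setT (fun z : n.+1.-tuple mR => tail_density M z).
Proof.
apply: (measurableT_comp measurable_sqrt).
apply: measurable_funD => //; apply: measurable_sum => i.
apply: measurable_funX; apply: measurable_funM; first exact: measurable_tnth_powR.
exact: measurable_radial.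
Qed.

Let measurable_side_density n (M : R) :
  measurable_fun setT (fun z : n.+1.-tuple mR => side_density M z).
Proof.
apply: measurable_funM; first exact: measurable_tnth_powR.
exact: measurable_radial.
Qed.

Let tail_density_ge0 n M (z : n.+1.-tuple R) : 0 <= tail_density M z.
Proof. exact: sqrtr_ge0. Qed.

Let tail_density_ge1 n M (z : n.+1.-tuple R) : 1 <= tail_density M z.
Proof.
by rewrite -[leLHS]sqrtr1 ler_wsqrtr// lerDl sumr_ge0// => i _; exact: sqr_ge0.
Qed.

Let side_density_ge0 n M (z : n.+1.-tuple R) : 0 <= side_density M z.
Proof. by rewrite mulr_ge0// powR_ge0. Qed.

Let tail_le_surface_density n (M : R) (z : n.+1.-tuple R) :
  tail_density M z <= surface_density M z.
Proof.
rewrite ler_wsqrtr// lerD2l /surface_density [leRHS]big_ord_recl lerDr; exact: sqr_ge0.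
Qed.

(** sqrt(A + b^2) <= sqrt A + b. *)
Let surface_density_le n (M : R) (z : n.+1.-tuple R) :
  surface_density M z <= tail_density M z + side_density M z.
Proof.
rewrite -[leRHS]gtr0_norm ?(lt_le_trans ltr01)//; last first.
  by rewrite (le_trans (tail_density_ge1 M z))// lerDl.
rewrite -sqrtr_sqr ler_wsqrtr// sqrrD /surface_density sqr_sqrtr; last first.
  by rewrite addr_ge0// sumr_ge0// => i _; exact: sqr_ge0.
rewrite big_ord_recl [X in 1 + X]addrC addrA lerD2r lerDl.
by rewrite mulrn_wge0// mulr_ge0.
Qed.

Section step.
Local Open Scope ereal_scope.
Context n (M : R) (g : n.+1.-tuple mR -> R).
Hypotheses (mg : measurable_fun setT g) (g0 : forall z, (0 <= g z)%R).

(** The two terms are the slices and the slope in the direction of the head, the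
latter integrated over the head first. The weight g is for exponential
moments. *)
Lemma surface_density_step_le :
  \int[leb n.+1]_(z in simplex M) (g z * surface_density M z)%:E <=
  \int[mu]_(x in `]0%R, +oo[) \int[leb n]_(y in simplex (M - x `^ p)%R)
    (g (cons_pair (y, x)) * surface_density (M - x `^ p) y)%:E +
  \int[leb n]_(y in simplex M) \int[mu]_(x in `]0%R, ((M - psum y) `^ p^-1)%R[)
    (g (cons_pair (y, x)) *
      (x `^ (p - 1) * (M - psum y - x `^ p) `^ (p^-1 - 1)))%:E.
Proof.
have mS := @measurable_simplex R p n.+1 M.
have mt : measurable_fun setT (fun z : n.+1.-tuple mR => (g z * tail_density M z)%:E).
  by apply/measurable_EFinP/measurable_funM => //; exact: measurable_tail_density.
have ms : measurable_fun setT (fun z : n.+1.-tuple mR => (g z * side_density M z)%:E).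
  by apply/measurable_EFinP/measurable_funM => //; exact: measurable_side_density.
have t0 z : 0 <= (g z * tail_density M z)%:E by rewrite lee_fin mulr_ge0.
have s0 z : 0 <= (g z * side_density M z)%:E by rewrite lee_fin mulr_ge0.
apply: (@le_trans _ _ (\int[leb n.+1]_(z in simplex M)
    ((g z * tail_density M z)%:E + (g z * side_density M z)%:E))).
  apply: nonneg_le_integral => z _.
    by rewrite lee_fin mulr_ge0// surface_density_ge0.
  by rewrite -EFinD lee_fin -mulrDr ler_wpM2l// surface_density_le.
rewrite ge0_integralD//; [|exact: measurable_funTS..].
rewrite (simplex_tonelli_head p M mt t0).
rewrite (simplex_tonelli_tail p0 M ms s0).
apply: leeD; rewrite le_eqVlt; apply/orP; left; apply/eqP.
 by apply: eq_integral => x _; apply: eq_integral => y _; rewrite tail_density_cons.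
apply: eq_integral => y _; apply: eq_integral => x _.
rewrite /side_density power_sum_cons tnth_cons_pair0; congr (_ * (_ * _ `^ _))%:E.
by rewrite opprD addrA addrAC.
Qed.

(** The slope in the direction of the head only increases the area element. *)
Lemma surface_density_step_ge (s : R) : (0 <= s)%R ->
  \int[mu]_(x in `]s, +oo[) \int[leb n]_(y in simplex (M - x `^ p)%R)
    (g (cons_pair (y, x)) * surface_density (M - x `^ p) y)%:E <=
  \int[leb n.+1]_(z in [set z | simplex M z /\ (s < tnth z ord0)%R])
    (g z * surface_density M z)%:E.
Proof.
move=> s0.
have mt : measurable_fun setT (fun z : n.+1.-tuple mR => (g z * tail_density M z)%:E).
  by apply/measurable_EFinP/measurable_funM => //; exact: measurable_tail_density.
have t0 z : 0 <= (g z * tail_density M z)%:E by rewrite lee_fin mulr_ge0.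
apply: (@le_trans _ _ (\int[leb n.+1]_(z in [set z | simplex M z /\ (s < tnth z ord0)%R])
    (g z * tail_density M z)%:E)); last first.
  apply: nonneg_le_integral => z _ //.
  by rewrite lee_fin ler_wpM2l.
rewrite (simplex_tonelli_headS p M mt t0 s0) le_eqVlt; apply/orP; left; apply/eqP.
by apply: eq_integral => x _; apply: eq_integral => y _; rewrite tail_density_cons.
Qed.
End step.
End density.

(** * Areas: slicing, scaling, finiteness *)
Section area.
Context {R : realType}.
Local Notation mR := (measurableTypeR R).
Local Notation mu := (@lebesgue_measure R).
Local Notation leb n := (@lebesgue_tuple R n).
Variable p : R.
Hypothesis p0 : 0 < p.
Local Notation psum := (power_sum p).
Local Notation simplex := (simplex p).
Local Notation density := (surface_density p).

Let powRV_cancel (M : R) : 0 < M -> (M `^ p^-1) `^ p = M.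
Proof. by move=> M0; rewrite -powRrM mulVf ?gt_eqF// powRr1// ltW. Qed.

Let powR1l r : 1 `^ r = 1 :> R. Proof. by rewrite powR1. Qed.

Let power_sum_dilate n (c : R) (y : n.-tuple mR) : 0 <= c -> (forall i, 0 < tnth y i) ->
  psum (dilate c y) = c `^ p * psum y.
Proof.
move=> c0 y0; rewrite /psum /power_sum mulr_sumr; apply: eq_bigr => i _.
by rewrite tnth_mktuple powRM// ltW.
Qed.

Let simplex_dilate n (M : R) (y : n.-tuple mR) : 0 < M ->
  simplex M (dilate (M `^ p^-1) y) <-> simplex 1 y.
Proof.
move=> M0; have c0 : 0 < M `^ p^-1 by rewrite powR_gt0.
split=> -[y0 yM].
  have {}y0 i : 0 < tnth y i by have := y0 i; rewrite tnth_mktuple pmulr_rgt0.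
  split => //; move: yM; rewrite power_sum_dilate ?ltW// powRV_cancel//.
  by rewrite gtr_pMr.
split=> [i|]; first by rewrite tnth_mktuple mulr_gt0.
by rewrite power_sum_dilate ?ltW// powRV_cancel// gtr_pMr.
Qed.

(** Slopes do not change under dilation. *)
Let surface_density_dilate n (M : R) (y : n.-tuple mR) : 0 < M -> simplex 1 y ->
  density M (dilate (M `^ p^-1) y) = density 1 y.
Proof.
move=> M0 [y0 y1]; have c0 : 0 < M `^ p^-1 by rewrite powR_gt0.
have h i : tnth (dilate (M `^ p^-1) y) i `^ (p - 1) *
     (M - psum (dilate (M `^ p^-1) y)) `^ (p^-1 - 1) =
   tnth y i `^ (p - 1) * (1 - psum y) `^ (p^-1 - 1).
  rewrite tnth_mktuple power_sum_dilate ?ltW// powRV_cancel//.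
  rewrite (_ : M - M * psum y = M * (1 - psum y)); last by rewrite mulrBr mulr1.
  rewrite !powRM ?ltW//; last by rewrite subr_gt0.
  rewrite mulrACA -powRrM -powRD; last by rewrite (gt_eqF M0) implybT.
  rewrite (_ : p^-1 * (p - 1) + (p^-1 - 1) = 0); last by field; rewrite gt_eqF.
  by rewrite powRr0 mul1r.
apply: (f_equal (fun S => Num.sqrt (1 + S))).
by apply: eq_bigr => i _; rewrite h.
Qed.

Local Open Scope ereal_scope.

Lemma simplex_integral_scale n (M : R) (F : n.-tuple mR -> \bar R) : (0 < M)%R ->
  measurable_fun setT F -> (forall y, 0 <= F y) ->
  \int[leb n]_(y in simplex M) F y =
  (M `^ (n%:R / p))%:E * \int[leb n]_(y in simplex 1%R) F (dilate (M `^ p^-1) y).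
Proof.
move=> M0 mF F0; have c0 : (0 < M `^ p^-1)%R by rewrite powR_gt0.
rewrite integral_mkcond (ge0_integral_dilate c0); last 2 first.
- apply/(measurable_restrictT F (@measurable_simplex R p n M)).
  exact: measurable_funTS.
- by move=> y; apply: erestrict_ge0.
rewrite -powR_mulrn ?powR_ge0// -powRrM [(p^-1 * _)%R]mulrC; congr (_ * _).
rewrite [RHS]integral_mkcond; apply: eq_integral => y _; rewrite !patchE.
by congr (if _ then _ else _); apply/idP/idP; rewrite !inE => /simplex_dilate; exact.
Qed.

Lemma lebesgue_measure_bnd (b1 b2 : bool) (a b : R) : (a < b)%R ->
  mu [set` Interval (BSide b1 a) (BSide b2 b)] = (b - a)%:E.
Proof. by move=> ab; rewrite lebesgue_measure_itv/= lte_fin ab EFinB. Qed.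

Lemma integral_cst_bnd (b1 b2 : bool) (a b : R) (c : \bar R) : (a < b)%R ->
  \int[mu]_(x in [set` Interval (BSide b1 a) (BSide b2 b)]) c = c * (b - a)%:E.
Proof. by move=> ab; rewrite integral_cst//= lebesgue_measure_bnd. Qed.

(** Locked, so that simplification does not unfold it into an integral. *)
Definition area n (M : R) : \bar R :=
  locked (\int[leb n]_(y in simplex M) (density M y)%:E).

Arguments area : simpl never.

Lemma areaE n (M : R) :
  area n M = \int[leb n]_(y in simplex M) (density M y)%:E.
Proof. by rewrite /area -lock. Qed.

Definition volume n (M : R) : \bar R := leb n (simplex M).

Lemma area_ge0 n M : 0 <= area n M.
Proof.
by rewrite areaE; apply: integral_ge0 => y _; rewrite lee_fin surface_density_ge0.
Qed.

Lemma simplex_le0 n (M : R) : (M <= 0)%R -> @simplex n M = set0.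
Proof. by move=> M0; apply/seteqP; split => // y /simplex_gt0; rewrite ltNge M0. Qed.

Lemma area_le0 n M : (M <= 0)%R -> area n M = 0.
Proof. by move=> M0; rewrite areaE simplex_le0// integral_set0. Qed.

Lemma area_scale n M : (0 < M)%R -> area n M = (M `^ (n%:R / p))%:E * area n 1.
Proof.
move=> M0.
have m : measurable_fun setT (fun y : n.-tuple mR => (density M y)%:E).
  by apply/measurable_EFinP; exact: measurable_surface_density.
have f0 (y : n.-tuple mR) : 0 <= (density M y)%:E.
  by rewrite lee_fin surface_density_ge0.
rewrite !areaE (simplex_integral_scale M0 m f0); apply: f_equal.
by apply: eq_integral => y; rewrite inE => h; rewrite surface_density_dilate.
Qed.

Lemma volumeE n M : volume n M = \int[leb n]_(y in simplex M) 1.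
Proof. by rewrite integral_cst ?mul1e//; exact: measurable_simplex. Qed.

Lemma volume_scale n M : (0 < M)%R -> volume n M = (M `^ (n%:R / p))%:E * volume n 1.
Proof.
move=> M0; rewrite !volumeE.
exact: (@simplex_integral_scale n M (cst 1) M0
  (@measurable_cst _ _ _ _ setT 1) (fun=> lee01)).
Qed.

Lemma volume_le_area n M : volume n M <= area n M.
Proof.
rewrite volumeE areaE; apply: nonneg_le_integral => y _//.
by rewrite lee_fin surface_density_ge1.
Qed.

(** The slope integrates to at most the length (M - sum)^(1/p) of the fibre, so the
left-hand side is at most the volume, which is at most the integral of the
areas of the slices because the area element is at least 1. *)
Let simplex_side_le n M :
  \int[leb n]_(y in simplex M) \int[mu]_(x in `]0%R, ((M - psum y) `^ p^-1)%R[)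
    (x `^ (p - 1) * (M - psum y - x `^ p) `^ (p^-1 - 1))%:E <=
  \int[mu]_(x in `]0%R, +oo[) area n (M - x `^ p)%R.
Proof.
apply: (@le_trans _ _ (\int[leb n]_(y in simplex M)
    \int[mu]_(x in `]0%R, ((M - psum y) `^ p^-1)%R[) 1)).
  apply: nonneg_le_integral => y [y0 yM].
    by apply: integral_ge0 => x _; rewrite lee_fin mulr_ge0 ?powR_ge0.
  have MS : (0 < M - psum y)%R by rewrite subr_gt0.
  apply: le_trans (integral_quadrant_weight_le p0 MS) _.
  by rewrite integral_cst_bnd ?powR_gt0// mul1e subr0.
pose h : n.+1.-tuple mR -> \bar R := cst 1.
have mh : measurable_fun setT h by exact: measurable_cst.
have h0 z : 0 <= h z by exact: lee01.
rewrite -(simplex_tonelli_tail p0 M mh h0) (simplex_tonelli_head p M mh h0).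
apply: nonneg_le_integral => x _; first exact: integral_ge0.
by rewrite areaE; apply: nonneg_le_integral => y _//; rewrite lee_fin surface_density_ge1.
Qed.

(** Only the factor 2 is lost, in every dimension; the constants of the lower
bound are free of N for this reason. *)
Lemma area_step_le n M : area n.+1 M <=
  2%:E * \int[mu]_(x in `]0%R, +oo[) area n (M - x `^ p)%R.
Proof.
pose g : n.+1.-tuple mR -> R := cst 1%R.
have mg : measurable_fun setT g by exact: measurable_cst.
have g0 z : (0 <= g z)%R by exact: ler01.
have := surface_density_step_le p0 M mg g0.
rewrite (_ : \int[leb n.+1]_(z in simplex M) _ = area n.+1 M); last first.
  by rewrite areaE; apply: eq_integral => z _; rewrite mul1r.
move/le_trans; apply; rewrite mule_natl mule2n; apply: leeD.
  by apply: nonneg_le_integral => x _; [apply: integral_ge0 => y _|rewrite areaE;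
    apply: nonneg_le_integral => y _]; rewrite mul1r ?lee_fin ?surface_density_ge0.
apply: le_trans (simplex_side_le n M); apply: nonneg_le_integral => y _.
  by apply: integral_ge0 => x _; rewrite lee_fin mul1r mulr_ge0 ?powR_ge0.
by apply: nonneg_le_integral => x _; rewrite mul1r// lee_fin mulr_ge0 ?powR_ge0.
Qed.

Lemma area_step_ge n M (s : R) : (0 <= s)%R ->
  \int[mu]_(x in `]s, +oo[) area n (M - x `^ p)%R <=
  \int[leb n.+1]_(z in [set z | simplex M z /\ (s < tnth z ord0)%R])
    (density M z)%:E.
Proof.
move=> s0; pose g : n.+1.-tuple mR -> R := cst 1%R.
have mg : measurable_fun setT g by exact: measurable_cst.
have g0 z : (0 <= g z)%R by exact: ler01.
have := surface_density_step_ge p M mg g0 s0.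
rewrite (_ : \int[leb n.+1]_(z in _) _ =
    \int[leb n.+1]_(z in [set z | simplex M z /\ (s < tnth z ord0)%R])
    (density M z)%:E); last first.
  by apply: eq_integral => z _; rewrite mul1r.
apply: le_trans; apply: nonneg_le_integral => x _; first exact: area_ge0.
rewrite areaE; apply: nonneg_le_integral => y _; rewrite ?mul1r//.
by rewrite lee_fin surface_density_ge0.
Qed.

Lemma area_homo n (M M' : R) : (M <= M')%R -> area n M <= area n M'.
Proof.
have [M0 _|M0 MM'] := leP M 0%R; first by rewrite area_le0// area_ge0.
rewrite area_scale// [leRHS]area_scale ?(lt_le_trans M0)//.
rewrite lee_wpmul2r ?area_ge0// lee_fin ge0_ler_powR ?nnegrE ?divr_ge0//; try exact: ltW.
exact: ltW (lt_le_trans M0 MM').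
Qed.

Lemma area0 : area 0 1 = 1.
Proof.
rewrite areaE /= integral_dirac//; last first.
- by apply/measurable_EFinP; exact: measurable_funTS (@measurable_surface_density R p 0 1).
- exact: measurable_simplex.
rewrite diracE mem_set ?mul1e; last by split=> [[]//|]; rewrite /power_sum big_ord0.
by rewrite /surface_density big_ord0 addr0 sqrtr1.
Qed.

(** Induction on the dimension: by area_step_le the area is at most twice the
integral over heads below 1 of slices no larger than the unit one. *)
Lemma area_lty n : area n 1 < +oo.
Proof.
elim: n => [|n IH]; first by rewrite area0 ltry.
apply: le_lt_trans (area_step_le n 1) _.
apply: (@le_lt_trans _ _ (2%:E * \int[mu]_(x in `]0%R, 1%R[) area n 1)); last first.
  rewrite integral_cst_bnd// subr0 mule1.
  by rewrite lte_mul_pinfty.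
apply: lee_wpmul2l; first by rewrite lee_fin ler0n.
apply: nonneg_le_integral_dom => x; [by move=> _; exact: area_ge0..| |];
  rewrite /= !in_itv/= andbT => x0.
  by move=> _; apply: area_homo; rewrite gerBl powR_ge0.
rewrite x0/= => /negP; rewrite -leNgt => x1.
by rewrite area_le0// subr_le0 -[leLHS](powR1l p) ge0_ler_powR ?nnegrE// ltW.
Qed.

(** Induction on the dimension: the slices at heads below 1/2 are not small. *)
Lemma area_gt0 n : 0 < area n 1.
Proof.
elim: n => [|n IH]; first by rewrite area0 lte01.
apply: (@lt_le_trans _ _ (\int[leb n.+1]_(z in
    [set z | simplex 1%R z /\ (0 < tnth z ord0)%R])
    (density 1%R z)%:E)); last first.
  rewrite areaE; apply: nonneg_subset_integral => [y _|y []//].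
  by rewrite lee_fin surface_density_ge0.
apply: lt_le_trans (area_step_ge n 1 (lexx 0%R)).
have [c c0 cx] : exists2 c : R, (0 < c)%R &
    forall x, (0 < x)%R -> (x <= 2^-1)%R -> (c <= 1 - x `^ p)%R.
  exists (1 - 2^-1 `^ p)%R.
    rewrite subr_gt0 -[ltRHS](powR1l p) gt0_ltr_powR ?nnegrE ?invr_ge0//.
    by rewrite invf_lt1// ltr1n.
  move=> x x0 x1; rewrite lerD2l lerN2.
  by rewrite ge0_ler_powR ?nnegrE ?invr_ge0//; exact: ltW.
apply: (@lt_le_trans _ _ (\int[mu]_(x in `]0%R, 2^-1%R]) area n c)).
  rewrite integral_cst_bnd ?invr_gt0// subr0.
  apply: mule_gt0; last by rewrite lte_fin invr_gt0 ltr0n.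
  by rewrite (area_scale n c0); apply: mule_gt0; [rewrite lte_fin powR_gt0|exact: IH].
apply: nonneg_le_integral_dom => x; [by move=> _; exact: area_ge0..| |];
  rewrite /= !in_itv/= andbT => /andP[x0 x1].
  by move=> _; apply: area_homo; exact: cx.
by rewrite x0.
Qed.
End area.
Arguments area : simpl never.

(** * Bounds for powers and exponentials *)
Section real_bounds.
Context {R : realType}.
Local Notation mu := (@lebesgue_measure R).
Implicit Types p r x z : R.

Lemma expR_half_le2 : expR (2^-1) <= 2 :> R.
Proof.
have : 2^-1 <= expR (- 2^-1) :> R by apply: le_trans (expR_ge1Dx _); lra.
by rewrite expRN lef_pV2 ?posrE ?expR_gt0.
Qed.

(** Young's inequality for x and 1. *)
Lemma powR_bernoulli p x : 1 <= p -> 0 <= x -> 1 + p * (x - 1) <= x `^ p.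
Proof.
move=> p1 x0; move: p1; rewrite le_eqVlt => /predU1P[<-|p1].
  by rewrite powRr1//; lra.
have p0 : 0 < p by apply: lt_trans p1.
have q0 : 0 < p / (p - 1) by rewrite divr_gt0 ?subr_gt0.
have pq : p^-1 + (p / (p - 1))^-1 = 1.
  by field; rewrite !gt_eqF// subr_gt0.
have := conjugate_powR x0 ler01 p0 q0 pq.
rewrite mulr1 powR1 mul1r invf_div => h.
have : p * x <= x `^ p + (p - 1).
  have := ler_wpM2l (ltW p0) h.
  by rewrite mulrDr mulrCA mulfV ?gt_eqF// mulr1 mulrCA mulfV ?gt_eqF// mulr1.
lra.
Qed.

Lemma powR_1B_le r z : 0 <= r -> z <= 1 -> (1 - z) `^ r <= expR (- (r * z)).
Proof.
move=> r0 z1; rewrite mulrC -mulNr expRM ge0_ler_powR ?nnegrE ?expR_ge0 ?subr_ge0//.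
exact: expR_ge1Dx.
Qed.

(** On [0, 2/3] one has (1 - z) (1 + 3z) >= 1. *)
Lemma powR_1B_ge r z : 0 <= r -> 0 <= z -> z <= 2 / 3 ->
  expR (- (3 * r * z)) <= (1 - z) `^ r.
Proof.
move=> r0 z0 z1.
have -> : - (3 * r * z) = - (3 * z) * r by ring.
have h1 : 0 < 1 - z by lra.
rewrite expRM ge0_ler_powR ?nnegrE ?expR_ge0 ?(ltW h1)//.
rewrite expRN -[leRHS]invrK lef_pV2 ?posrE ?expR_gt0 ?invr_gt0//.
apply: le_trans (expR_ge1Dx _).
rewrite -[leLHS]mul1r ler_pdivrMr//.
have -> : (1 + 3 * z) * (1 - z) = 1 + z * (2 - 3 * z) by ring.
by rewrite lerDl mulr_ge0//; lra.
Qed.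

Local Open Scope ereal_scope.

Lemma integral_expR_half_le :
  \int[mu]_(x in `]0%R, +oo[) (expR (- (2^-1 * x)))%:E <= 2%:E.
Proof.
have h2 : (0 < 2^-1 :> R)%R by rewrite invr_gt0.
have <- : 2%:E * \int[mu]_x (exponential_pdf 2^-1 x)%:E = 2%:E :> \bar R.
  by rewrite integral_exponential_pdf// mule1.
rewrite -ge0_integralZl_EFin//; last 2 first.
- by move=> x _; rewrite lee_fin exponential_pdf_ge0// ltW.
- by apply/measurable_EFinP; exact: measurable_exponential_pdf.
apply: nonneg_le_integral_dom => x.
- by move=> _; rewrite lee_fin expR_ge0.
- by move=> _; rewrite -EFinM lee_fin mulr_ge0// exponential_pdf_ge0// ltW.
- rewrite /= in_itv/= andbT => x0 _.
  rewrite -EFinM lee_fin /exponential_pdf patchE mem_set/= ?in_itv/= ?(ltW x0)//.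
  by rewrite mulrA mulfV// mul1r mulNr.
- by move=> _ /(_ I).
Qed.

(** By powR_bernoulli the integrand is at most 2 exp(-x/2), uniformly in p. *)
Lemma integral_expR_powR_le p : (1 <= p)%R ->
  \int[mu]_(x in `]0%R, +oo[) (expR (- ((2 * p)^-1 * x `^ p)))%:E <= 4%:E.
Proof.
move=> p1; have p0 : (0 < p)%R by apply: lt_le_trans p1.
apply: (@le_trans _ _ (2%:E *
    \int[mu]_(x in `]0%R, +oo[) (expR (- (2^-1 * x)))%:E)); last first.
  rewrite (_ : 4%:E = 2%:E * 2%:E :> \bar R); last by rewrite -EFinM; congr EFin; ring.
  by apply: lee_wpmul2l; [rewrite lee_fin|exact: integral_expR_half_le].
rewrite -ge0_integralZl_EFin//; last first.
  apply/measurable_EFinP; apply: (measurableT_comp (@measurable_expR R)).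
  by apply: measurable_funN => //; apply: measurable_funM.
apply: nonneg_le_integral => x; rewrite /= in_itv/= andbT => x0.
  by rewrite lee_fin expR_ge0.
rewrite -EFinM lee_fin.
apply: (@le_trans _ _ (expR (2^-1 + - (2^-1 * x)))%R); last first.
  by rewrite expRD ler_wpM2r ?expR_ge0// expR_half_le2.
rewrite ler_expR.
have h := powR_bernoulli p1 (ltW x0).
have : ((2 * p)^-1 * (1 + p * (x - 1)) <= (2 * p)^-1 * x `^ p)%R.
  by rewrite ler_wpM2l// invr_ge0 mulr_ge0// ltW.
have -> : ((2 * p)^-1 * (1 + p * (x - 1)) = (2 * p)^-1 + 2^-1 * x - 2^-1)%R.
  by field; rewrite gt_eqF.
have : (0 <= (2 * p)^-1)%R by rewrite invr_ge0 mulr_ge0// ltW.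
move: ((2 * p)^-1)%R => c; lra.
Qed.
End real_bounds.

(** * Lower bound: the measure of a cap *)
Section cap.
Context {R : realType}.
Local Notation mu := (@lebesgue_measure R).
Local Notation leb n := (@lebesgue_tuple R n).
Variable p : R.
Hypothesis p1 : 1 <= p.
Local Notation simplex := (simplex p).
Local Notation density := (surface_density p).
Local Notation area := (area p).

Let p0 : 0 < p. Proof. exact: lt_le_trans p1. Qed.

Let powR_split m (N z : R) : 0 < N -> z <= 1 ->
  (N - N * z) `^ (m%:R / p) = N `^ (m%:R / p) * (1 - z) `^ (m%:R / p).
Proof.
move=> N0 z1; rewrite -powRM ?subr_ge0//; last exact: ltW.
by rewrite mulrBr mulr1.
Qed.

Local Open Scope ereal_scope.

(** The slice at height x has relative area (1 - x^p/N)^(m/p), and m/N is at least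
1/2; what remains is the integral of exp(-x^p/(2p)). *)
Lemma area_slice_le m (N : R) : (0 < N)%R -> (N <= 2 * m%:R)%R ->
  area m.+1 N <= (8 * N `^ (m%:R / p))%:E * area m 1%R.
Proof.
move=> N0 Nm; apply: le_trans (area_step_le p0 m N) _.
rewrite (_ : 8 = 2 * 4)%R; last by ring.
rewrite -mulrA EFinM -muleA; apply: lee_wpmul2l; first by rewrite lee_fin.
set c := (N `^ (m%:R / p))%:E * area m 1%R.
have c0 : 0 <= c by rewrite mule_ge0 ?area_ge0// lee_fin powR_ge0.
rewrite EFinM -muleA -/c [leRHS]muleC.
apply: (@le_trans _ _ (c *
    \int[mu]_(x in `]0%R, +oo[) (expR (- ((2 * p)^-1 * x `^ p)))%:E)); last first.
  by apply: lee_wpmul2l => //; exact: integral_expR_powR_le.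
rewrite -ge0_integralZl//; last first.
  apply/measurable_EFinP; apply: (measurableT_comp (@measurable_expR R)).
  apply: measurable_funN => //; apply: measurable_funM => //.
  by apply: measurable_funTS; exact: measurable_powR.
apply: nonneg_le_integral => x; rewrite /= in_itv/= andbT => x0; first exact: area_ge0.
have [xN|xN] := leP N (x `^ p)%R.
  by rewrite area_le0 ?subr_le0//; apply: mule_ge0 => //; rewrite lee_fin expR_ge0.
rewrite (area_scale p0) ?subr_gt0// /c muleAC; apply: lee_wpmul2r; first exact: area_ge0.
rewrite -EFinM lee_fin.
have [z zE] : exists z, (x `^ p = N * z)%R.
  by exists (N^-1 * x `^ p)%R; rewrite mulrA mulfV ?gt_eqF// mul1r.
have z1 : (z <= 1)%R by move: xN; rewrite zE -ltr_pdivlMl// mulVf ?gt_eqF// => /ltW.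
have z0 : (0 <= z)%R by rewrite -(pmulr_rge0 _ N0) -zE powR_ge0.
rewrite zE powR_split// ler_wpM2l ?powR_ge0//.
apply: le_trans (powR_1B_le _ z1) _; first by rewrite divr_ge0// ltW.
rewrite ler_expR lerN2 mulrA ler_wpM2r//.
rewrite invfM -mulrA [(p^-1 * N)%R]mulrC mulrA ler_pM2r ?invr_gt0//.
lra.
Qed.

(** It suffices to keep the heights between s and s (1 + 1/(4p)): the slices there
still have relative area at least exp(-4 s^p/p). *)
Lemma cap_area_ge m (N s : R) : (m%:R <= N)%R -> (0 < s)%R -> (s `^ p <= N / 2)%R ->
  (N `^ (m%:R / p) * expR (- (4 * s `^ p / p)) * (s / (4 * p)))%:E * area m 1%R <=
  \int[leb m.+1]_(z in [set z | simplex N z /\ (s < tnth z ord0)%R])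
    (density N z)%:E.
Proof.
move=> mN s0 sN; apply: le_trans (area_step_ge p m N (ltW s0)).
have sp0 : (0 < s `^ p)%R by rewrite powR_gt0.
have N0 : (0 < N)%R by lra.
(* b^p <= exp(1/4) s^p <= 4/3 s^p, hence x^p/N <= 2/3 up to height b. *)
pose b := (s * (1 + (4 * p)^-1))%R.
have sb : (s < b)%R by rewrite /b ltr_pMr// ltrDl invr_gt0 mulr_gt0.
set c := (N `^ (m%:R / p) * expR (- (4 * s `^ p / p)))%:E * area m 1%R.
apply: (@le_trans _ _ (\int[mu]_(x in `]s, b]) c)).
  rewrite integral_cst_bnd// /c EFinM muleAC.
  apply: lee_wpmul2l.
    by apply: mule_ge0; [rewrite lee_fin mulr_ge0 ?powR_ge0 ?expR_ge0|exact: area_ge0].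
  by rewrite lee_fin /b mulrDr mulr1 addrAC subrr add0r.
have c0 : 0 <= c.
  by apply: mule_ge0; [rewrite lee_fin mulr_ge0 ?powR_ge0 ?expR_ge0|exact: area_ge0].
have bp : (b `^ p <= 4 / 3 * s `^ p)%R.
  rewrite /b powRM ?(ltW s0) ?addr_ge0 ?invr_ge0 ?mulr_ge0 ?(ltW p0)//.
  rewrite mulrC ler_wpM2r ?powR_ge0//.
  apply: (@le_trans _ _ (expR (4^-1)))%R.
    rewrite (_ : 4^-1 = (4 * p)^-1 * p)%R; last by field; rewrite gt_eqF.
    rewrite expRM ge0_ler_powR ?nnegrE ?expR_ge0 ?(ltW p0) ?expR_ge1Dx//.
    by rewrite addr_ge0 ?invr_ge0 ?mulr_ge0 ?(ltW p0).
  rewrite -[leRHS]invrK -[leLHS]invrK lef_pV2 ?posrE ?invr_gt0 ?expR_gt0//.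
  by rewrite -expRN; apply: le_trans (expR_ge1Dx _); lra.
apply: nonneg_le_integral_dom => x; [by []|by move=> _; exact: area_ge0| |];
  rewrite /= !in_itv/= andbT => /andP[sx xb]; last by rewrite sx.
move=> _.
have x0 : (0 < x)%R by exact: lt_trans sx.
have xp : (x `^ p <= 4 / 3 * s `^ p)%R.
  apply: le_trans bp.
  by rewrite ge0_ler_powR ?nnegrE ?(ltW p0) ?(ltW x0) ?(le_trans (ltW x0) xb).
have [z zE] : exists z, (x `^ p = N * z)%R.
  by exists (N^-1 * x `^ p)%R; rewrite mulrA mulfV ?gt_eqF// mul1r.
have z0 : (0 <= z)%R by rewrite -(pmulr_rge0 _ N0) -zE powR_ge0.
have z23 : (z <= 2 / 3)%R.
  rewrite -(ler_pM2l N0) -zE; lra.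
have NxE : (0 < N - x `^ p)%R.
  have : (x `^ p <= 2 / 3 * N)%R by lra.
  lra.
rewrite /c [leRHS](area_scale p0)//; apply: lee_wpmul2r; first exact: area_ge0.
rewrite lee_fin zE powR_split//; last lra.
rewrite ler_wpM2l ?powR_ge0//.
apply: le_trans (powR_1B_ge _ z0 z23); last by rewrite divr_ge0// ltW.
rewrite ler_expR lerN2.
rewrite (_ : 3 * (m%:R / p) * z = (3 * m%:R * z) / p)%R; last by ring.
rewrite ler_pM2r ?invr_gt0//.
have : (m%:R * z <= N * z)%R by rewrite ler_wpM2r.
lra.
Qed.
End cap.

Section quadrant.
Context {R : realType}.
Implicit Types p q s t : R.

(** Quadratic growth is what absorbs factors polynomial in p. *)
Lemma powR2_ge_sqr p : 0 <= p -> p ^+ 2 / 16 <= 2 `^ p :> R.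
Proof.
move=> p0; apply: (@le_trans _ _ (expR (2^-1 * p))); last first.
  by rewrite expRM ge0_ler_powR ?nnegrE ?expR_ge0// expR_half_le2.
rewrite (_ : 2^-1 * p = (p / 4) * 2%:R); last by field.
rewrite expRM_natr (_ : p ^+ 2 / 16 = (p / 4) ^+ 2); last by field.
rewrite ler_sqr ?nnegrE ?expR_ge0 ?divr_ge0//.
by apply: le_trans (expR_ge1Dx _); rewrite lerDr.
Qed.

Lemma ltr_powR2 (r a b : R) : 0 < r -> 0 <= a -> 0 <= b ->
  (a `^ r < b `^ r) = (a < b).
Proof.
move=> r0 a0 b0; apply/idP/idP => [|h]; last by rewrite gt0_ltr_powR ?nnegrE.
by apply: contraTT; rewrite -!leNgt => h; rewrite ge0_ler_powR ?nnegrE// ltW.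
Qed.

Local Open Scope ereal_scope.

Lemma graph_area_setT n p : (0 < p)%R ->
  graph_area (@quadrant_dom R n p) (quadrant_fun p) setT = area p n n.+1%:R.
Proof. by move=> p0; rewrite graph_area_quadrantE// preimage_setT setIT areaE. Qed.

Lemma area_fin_num n p (M : R) : (0 < p)%R -> (0 < M)%R -> area p n M \is a fin_num.
Proof.
move=> p0 M0; rewrite (area_scale p0)// fin_numM// ge0_fin_numE ?area_ge0//.
exact: area_lty.
Qed.

Lemma fine_area_gt0 n p (M : R) : (0 < p)%R -> (0 < M)%R -> (0 < fine (area p n M))%R.
Proof.
move=> p0 M0; rewrite fine_gt0// -ge0_fin_numE ?area_ge0// area_fin_num// andbT.
rewrite (area_scale p0)//; apply: mule_gt0; first by rewrite lte_fin powR_gt0.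
exact: area_gt0.
Qed.

Lemma graph_area_fin_num n p A : (0 < p)%R ->
  graph_area (@quadrant_dom R n p) (quadrant_fun p) A \is a fin_num.
Proof.
move=> p0; rewrite graph_area_quadrantE//.
have d0 (y : n.-tuple R) : 0 <= (surface_density p n.+1%:R y)%:E.
  by rewrite lee_fin surface_density_ge0.
rewrite ge0_fin_numE; last by apply: integral_ge0 => y _; exact: d0.
apply: le_lt_trans (_ : area p n n.+1%:R < +oo).
  by rewrite areaE; apply: nonneg_subset_integral => [y _|y []//]; exact: d0.
by rewrite -ge0_fin_numE ?area_ge0// area_fin_num.
Qed.

Lemma quadrant_measure_ge n p A (a : R) : (0 < p)%R ->
  (a * fine (area p n n.+1%:R))%:E <=
    graph_area (@quadrant_dom R n p) (quadrant_fun p) A ->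
  (a <= quadrant_measure p A)%R.
Proof.
move=> p0 h; rewrite /quadrant_measure graph_area_setT//.
rewrite ler_pdivlMr ?fine_area_gt0//.
by rewrite -lee_fin fineK// graph_area_fin_num.
Qed.

Lemma quadrant_measure_le n p A (a : R) : (0 < p)%R ->
  graph_area (@quadrant_dom R n p) (quadrant_fun p) A <=
    (a * fine (area p n n.+1%:R))%:E ->
  (quadrant_measure p A <= a)%R.
Proof.
move=> p0 h; rewrite /quadrant_measure graph_area_setT//.
rewrite ler_pdivrMr ?fine_area_gt0//.
by rewrite -lee_fin fineK// graph_area_fin_num.
Qed.

Local Close Scope ereal_scope.

Lemma Lrn_norm_gt n (q t : R) (u : n.+1.-tuple R) : 0 < q -> 0 <= t ->
  (forall i, 0 <= tnth u i) ->
  (t < Lrn_norm q u) = (t `^ q * n.+1%:R < \sum_(i < n.+1) tnth u i `^ q).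
Proof.
move=> q0 t0 u0; rewrite /Lrn_norm.
rewrite (eq_bigr (fun i => tnth u i `^ q)); last by move=> i _; rewrite ger0_norm.
set S := \sum_(i < _) _.
have S0 : 0 <= n.+1%:R^-1 * S.
  by rewrite mulr_ge0 ?invr_ge0// sumr_ge0// => i _; exact: powR_ge0.
rewrite -ltr_pdivlMr// [S / _]mulrC.
transitivity ((t `^ q) `^ q^-1 < (n.+1%:R^-1 * S) `^ q^-1).
  by rewrite -[in RHS]powRrM mulfV ?gt_eqF// powRr1.
by rewrite ltr_powR2 ?invr_gt0 ?powR_ge0.
Qed.

End quadrant.

Section lower_bound.
Context {R : realType}.
Local Notation mR := (measurableTypeR R).
Local Notation leb n := (@lebesgue_tuple R n).
Implicit Types p q s t : R.

Lemma sum_graph_point n (F : R -> R) (f : n.-tuple R -> R) y :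
  \sum_(i < n.+1) F (tnth (graph_point f y) i) =
  \sum_(i < n) F (tnth y i) + F (f y).
Proof.
rewrite big_ord_recr /=; congr (_ + F _); last first.
  by rewrite (tnth_nth 0) /= nth_rcons size_tuple ltnn eqxx.
apply: eq_bigr => i _; congr F.
by rewrite !(tnth_nth 0) /= nth_rcons size_tuple ltn_ord.
Qed.

Lemma simplex_quadrant n p (y : n.-tuple R) : 0 < p ->
  simplex p n.+1%:R y ->
  Lpn_quadrant p (graph_point (quadrant_fun p) y) /\
  forall i, 0 < tnth (graph_point (quadrant_fun p) y) i.
Proof.
move=> p0 hy.
have : (graph_point (quadrant_fun p) @` @quadrant_dom R n p)
    (graph_point (quadrant_fun p) y) by exists y.
by rewrite -(quadrant_graph n p0).
Qed.

(** The left-hand side is the p-th power of the height t N^(1/q) at which a single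
coordinate makes the L_q norm exceed t. *)
Lemma powR_threshold p q t (N : R) : 0 <= t -> 0 <= N ->
  (t * N `^ q^-1) `^ p = t `^ p * N `^ (p / q).
Proof.
by move=> t0 N0; rewrite powRM ?powR_ge0// -powRrM [q^-1 * p]mulrC.
Qed.

(** The factor p is the price of the width s/(4p) of the cap; it is paid for by the
exponential because s^p/p is at least of order p. *)
Lemma le_expR_powR p s : 1 <= p -> 2 <= s -> 16 * p <= expR (256 * s `^ p / p).
Proof.
move=> p1 s2; have p0 : 0 < p by apply: lt_le_trans p1.
have h : p ^+ 2 / 16 <= s `^ p.
  apply: le_trans (powR2_ge_sqr (ltW p0)) _.
  by rewrite ge0_ler_powR ?nnegrE ?(ltW p0)//; apply: le_trans s2.
apply: le_trans (_ : 16 * p <= 256 * s `^ p / p) _.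
  rewrite ler_pdivlMr//; move: h; rewrite ler_pdivrMr// expr2; lra.
by apply: le_trans (expR_ge1Dx _); rewrite lerDr.
Qed.

(** The cap of points whose first coordinate exceeds s = t N^(1/q) lies in the
event. Since t is at most half of its maximal value, s^p <= N/2, so that
cap_area_ge applies. *)
Theorem quadrant_tail_ge n p q t : 1 <= p -> p < q -> 2 <= t ->
  t <= 2^-1 * n.+1%:R `^ (p^-1 - q^-1) ->
  expR (- (260 / p * t `^ p * n.+1%:R `^ (p / q))) <= quadrant_tail n p q t.
Proof.
move=> p1 pq t2 tN.
have p0 : 0 < p by apply: lt_le_trans p1.
have q0 : 0 < q by apply: lt_trans pq.
have t0 : 0 < t by lra.
case: n tN => [|m]; first by rewrite powR1; lra.
set N : R := m.+2%:R => tN.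
have N0 : 0 < N by rewrite ltr0n.
have N1 : 1 <= N by rewrite ler1n.
pose s := t * N `^ q^-1.
have s2 : 2 <= s.
  rewrite -[leLHS]mulr1 ler_pM//.
  by rewrite -[leLHS](powRr0 N) ler_powR// invr_ge0 ltW.
have s0 : 0 < s by lra.
have sp : s `^ p = t `^ p * N `^ (p / q) by rewrite powR_threshold ?ltW.
have N2s : 2 `^ p * s `^ p <= N.
  have : 2 * s <= N `^ p^-1.
    rewrite /s mulrA -ler_pdivlMr ?powR_gt0//.
    rewrite -powRB; last by rewrite (gt_eqF N0) implybT.
    lra.
  rewrite -powRM ?(ltW s0)// => h.
  have -> : N = (N `^ p^-1) `^ p by rewrite -powRrM mulVf ?gt_eqF// powRr1 ?ltW.
  have h0 : 0 <= 2 * s by lra.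
  by rewrite ge0_ler_powR ?nnegrE ?powR_ge0 ?(ltW p0).
have p2 : 2 <= 2 `^ p :> R by rewrite -[leLHS]powRr1// ler_powR// ler1n.
have sp2 : 2 <= s `^ p.
  apply: le_trans p2 _; rewrite ge0_ler_powR ?nnegrE ?(ltW p0) ?(ltW s0)//.
have sN : s `^ p <= N / 2.
  rewrite ler_pdivlMr// mulrC; apply: le_trans N2s.
  by rewrite ler_wpM2r// ltW// powR_gt0.
have N4 : 4 <= N by lra.
have NE : N = m%:R + 2.
  by rewrite /N -[m.+2]addn2 natrD.
apply: quadrant_measure_ge => //.
rewrite graph_area_quadrantE// -/N.
pose cap := [set z : m.+1.-tuple mR | simplex p N z /\ s < tnth z ord0].
have capP : forall z, cap z -> let u := graph_point (quadrant_fun p) z in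
    Lpn_quadrant p u /\ t < Lrn_norm q u.
  move=> z [zN sz].
  have [hL hpos] : Lpn_quadrant p (graph_point (quadrant_fun p) z) /\
    forall i, 0 < tnth (graph_point (quadrant_fun p) z) i.
    exact: simplex_quadrant.
  split => //; rewrite Lrn_norm_gt ?(ltW t0)//; last by move=> i; rewrite ltW.
  rewrite (sum_graph_point (fun x => x `^ q)) big_ord_recl -addrA.
  have -> : t `^ q * m.+2%:R = s `^ q.
    rewrite /s powRM ?powR_ge0 ?(ltW t0)// -powRrM mulVf ?gt_eqF// powRr1 ?(ltW N0)//.
  apply: (@lt_le_trans _ _ (tnth z ord0 `^ q)).
    by rewrite ltr_powR2 ?(ltW s0) ?(ltW (lt_trans s0 sz)).
  by rewrite lerDl addr_ge0 ?powR_ge0// sumr_ge0// => i _; exact: powR_ge0.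
apply: (@le_trans _ _ (\int[leb m.+1]_(z in cap) (surface_density p N z)%:E)%E); last first.
  apply: nonneg_subset_integral => [y _|y hy]; first by rewrite lee_fin surface_density_ge0.
  by split; [exact: hy.1|exact: capP].
apply: le_trans (cap_area_ge (m := m) p1 _ s0 sN); last by rewrite NE lerDl.
have a0 := fine_area_gt0 m p0 ltr01.
have aE : area p m 1 = (fine (area p m 1))%:E by rewrite fineK// area_fin_num.
have hup : fine (area p m.+1 N) <= 8 * N `^ (m%:R / p) * fine (area p m 1).
  rewrite -lee_fin fineK ?area_fin_num// EFinM -aE.
  by apply: area_slice_le => //; lra.
rewrite aE -EFinM lee_fin.
apply: le_trans (ler_wpM2l (expR_ge0 _) hup) _.
rewrite [leLHS]mulrA ler_pM2r//.
set K := N `^ (m%:R / p); have K0 : 0 < K by rewrite powR_gt0.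
rewrite [X in X <= _](_ : _ =
  K * (8 * expR (- (260 / p * t `^ p * N `^ (p / q))))); last by ring.
have -> : 260 / p * t `^ p * N `^ (p / q) = 4 * s `^ p / p + 256 * s `^ p / p.
  by rewrite sp; field; rewrite gt_eqF.
rewrite opprD expRD -[leRHS]mulrA ler_pM2l// mulrCA ler_wpM2l ?expR_ge0//.
rewrite expRN -ler_pdivlMr ?invr_gt0 ?expR_gt0// invrK.
have : 16 * p * (s / (4 * p)) <= expR (256 * s `^ p / p) * (s / (4 * p)).
  apply: ler_wpM2r; last exact: le_expR_powR.
  by apply: divr_ge0; [exact: ltW|apply: mulr_ge0 => //; exact: ltW].
have -> : 16 * p * (s / (4 * p)) = 4 * s by field; rewrite gt_eqF.
rewrite [X in _ <= X -> _]mulrC; apply: le_trans; lra.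
Qed.
End lower_bound.

(** * Majorization of subset sums *)
Section majorization.
Context {R : realType}.

(** Summation by parts. *)
Lemma abel_sum_le0 (b d : nat -> R) N :
  (forall k, (k.+1 < N)%N -> b k.+1 <= b k) -> (forall k, (k < N)%N -> 0 <= b k) ->
  (forall m, (m <= N)%N -> \sum_(k < m) d k <= 0) ->
  \sum_(k < N) b k * d k <= 0.
Proof.
case: N => [|N]; first by rewrite big_ord0.
move=> bd b0 D0.
suff h m : (m <= N)%N -> \sum_(k < m.+1) b k * d k <= b m * \sum_(k < m.+1) d k.
  by apply: le_trans (h N (leqnn N)) _; rewrite mulr_ge0_le0 ?b0 ?D0.
elim: m => [|m IH] mN; first by rewrite !big_ord1.
rewrite big_ord_recr/= [in leRHS]big_ord_recr/= mulrDr lerD2r.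
apply: le_trans (IH (ltnW mN)) _.
by rewrite ler_wnM2r ?bd ?D0// ltnW.
Qed.

(** Convexity: the tangent at x lies below the graph. This is Young's inequality
for x^(a-1) and y. *)
Lemma powR_tangent (a x y : R) : 1 <= a -> 0 <= x -> 0 <= y ->
  x `^ a - y `^ a <= a * (x `^ (a - 1) * (x - y)).
Proof.
rewrite le_eqVlt => /predU1P[<- x0 y0|a1 x0 y0].
  by rewrite subrr powRr0 !mul1r !powRr1.
have a0 : 0 < a by apply: lt_trans a1.
have q0 : 0 < a / (a - 1) by rewrite divr_gt0 ?subr_gt0.
have pq : (a / (a - 1))^-1 + a^-1 = 1.
  by field; rewrite !gt_eqF// subr_gt0.
have := conjugate_powR (powR_ge0 x (a - 1)) y0 q0 a0 pq.
rewrite -powRrM mulrCA mulfV ?gt_eqF ?subr_gt0// mulr1 invf_div => h.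
have e : x `^ (a - 1) * x = x `^ a by rewrite mulrC mulr_powRB1.
have := ler_wpM2l (ltW a0) h.
rewrite [X in _ <= X -> _]mulrDr.
rewrite [a * (y `^ a / a)]mulrCA mulfV ?gt_eqF// mulr1.
rewrite [a * (x `^ a * _)]mulrCA [a * ((a - 1) / a)]mulrCA mulfV ?gt_eqF// mulr1.
rewrite [x `^ (a - 1) * (x - y)]mulrBr e; lra.
Qed.

(** Let x be v sorted in nonincreasing order. The sets of the largest entries show
that the partial sums of x are at most those of w. The slopes x_k^(a-1) of the
tangents at x are nonincreasing, so summation by parts bounds the sum of
x_k^a - w_k^a above by 0. *)
Lemma majorized_sum_powR (a : R) N (v : 'I_N -> R) (w : nat -> R) : 1 <= a ->
  (forall i, 0 <= v i) -> (forall k, (k < N)%N -> 0 <= w k) ->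
  (forall A : {set 'I_N}, \sum_(i in A) v i <= \sum_(k < #|A|) w k) ->
  \sum_i v i `^ a <= \sum_(k < N) w k `^ a.
Proof.
move=> a1 v0 w0 vw.
case: N v v0 w0 vw => [v _ _ _|N v v0 w0 vw]; first by rewrite !big_ord0.
pose r : rel 'I_N.+1 := fun i j => v j <= v i.
pose s := sort r (enum 'I_N.+1).
have rt : total r by move=> i j; rewrite /r le_total.
have rtr : transitive r by move=> i j k; rewrite /r => h1 h2; exact: le_trans h1.
have sz : size s = N.+1 by rewrite size_sort size_enum_ord.
have us : uniq s by rewrite sort_uniq enum_uniq.
have ss : sorted r s by exact: sort_sorted.
pose x k := v (nth ord0 s k).
have xd k : (k.+1 < N.+1)%N -> x k.+1 <= x k.
  move=> kN; have /(sortedP ord0) := ss; apply; by rewrite sz.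
have sumx m : (m <= N.+1)%N -> \sum_(k < m) x k <= \sum_(k < m) w k.
  move=> mN.
  have st : size (take m s) = m by rewrite size_takel ?sz.
  have ut : uniq (take m s) by rewrite take_uniq.
  have cA : #|[set i in take m s]| = m.
    by rewrite cardsE (card_uniqP ut).
  have := vw [set i in take m s]; rewrite cA.
  rewrite (eq_bigl (mem (take m s))); last by move=> i; rewrite inE.
  rewrite -big_uniq//= (big_nth ord0) st big_mkord.
  move=> h; apply: le_trans h; rewrite le_eqVlt; apply/orP; left; apply/eqP.
  by apply: eq_bigr => k _; rewrite nth_take.
have -> : \sum_i v i `^ a = \sum_(k < N.+1) x k `^ a.
  transitivity (\sum_(i <- s) v i `^ a).
    rewrite -big_enum/=; apply: perm_big; rewrite perm_sym.
    by apply/permPl; exact: perm_sort.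
  by rewrite (big_nth ord0) sz big_mkord.
rewrite -subr_le0 -sumrB.
apply: (@le_trans _ _ (a * \sum_(k < N.+1) x k `^ (a - 1) * (x k - w k))).
  rewrite mulr_sumr; apply: ler_sum => k _.
  by apply: powR_tangent => //; [exact: v0|exact: w0].
rewrite mulr_ge0_le0 ?(le_trans ler01)//.
apply: (@abel_sum_le0 (fun k => x k `^ (a - 1)) (fun k => x k - w k)) => [k kN|k _|m mN].
- by rewrite ge0_ler_powR ?nnegrE ?subr_ge0 ?v0// xd.
- exact: powR_ge0.
- by rewrite sumrB subr_le0 sumx.
Qed.
End majorization.

Section profile.
Context {R : realType}.

(** log(e N/(k+1)), the natural scale of the (k+1)-st largest among N exponential
variables. Its sums dominate the logarithm of the number of subsets:
exp(- sum_(k < m) profile N k) = m!/(eN)^m. *)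
Definition profile (N k : nat) : R := 1 + ln (N%:R / k.+1%:R).

Lemma profile_arg_ge1 N k : (k < N)%N -> 1 <= N%:R / k.+1%:R :> R.
Proof. by move=> kN; rewrite ler_pdivlMr// mul1r ler_nat. Qed.

Lemma profile_ge1 N k : (k < N)%N -> 1 <= profile N k.
Proof. by move=> kN; rewrite lerDl ln_ge0// profile_arg_ge1. Qed.

Lemma profile_ge0 N k : (k < N)%N -> 0 <= profile N k.
Proof. by move=> /profile_ge1; apply: le_trans. Qed.

Lemma sum_profile_log_le (a : R) N : 0 <= a ->
  \sum_(k < N) profile N k `^ a <= (1 + ln N%:R) `^ a * N%:R.
Proof.
move=> a0; apply: (@le_trans _ _ (\sum_(k < N) (1 + ln N%:R) `^ a)); last first.
  by rewrite sumr_const card_ord mulr_natr.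
apply: ler_sum => k _.
have N1 : 1 <= N%:R :> R by rewrite ler1n (leq_ltn_trans _ (ltn_ord k)).
have h : profile N k <= 1 + ln N%:R.
  rewrite lerD2l ler_ln ?posrE//; last 2 first.
  - by apply: lt_le_trans (profile_arg_ge1 (ltn_ord k)).
  - by apply: lt_le_trans N1.
  by rewrite ler_pdivrMr// ler_peMr ?ler1n// (le_trans _ N1).
by rewrite ge0_ler_powR ?nnegrE ?profile_ge0// (le_trans (profile_ge0 (ltn_ord k))).
Qed.

Lemma sum_inv_sqrt_le m : \sum_(k < m) (Num.sqrt k.+1%:R)^-1 <= 2 * Num.sqrt m%:R :> R.
Proof.
elim: m => [|m IH]; first by rewrite big_ord0 mulr_ge0// sqrtr_ge0.
rewrite big_ord_recr/=; apply: le_trans (lerD IH (lexx _)) _.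
set A := Num.sqrt m%:R; set B := Num.sqrt m.+1%:R.
have B0 : 0 < B by rewrite sqrtr_gt0.
have AB : B ^+ 2 = A ^+ 2 + 1 by rewrite !sqr_sqrtr// natr1.
rewrite -(ler_pM2r B0) mulrDl mulVf ?gt_eqF//.
have : 0 <= (A - B) ^+ 2 by exact: sqr_ge0.
move: AB; rewrite !expr2; lra.
Qed.

(** From log y <= 2a y^(1/(2a)), the a-th powers are at most multiples of the
square roots of N/(k+1), whose sum is of order N. This bound gives the q in the
minimum of q and log N; sum_profile_log_le gives the log N. *)
Lemma sum_profile_powR_le (a : R) N : 1 <= a ->
  \sum_(k < N) profile N k `^ a <= (8 * a) `^ a * N%:R.
Proof.
move=> a1; have a0 : 0 < a by apply: lt_le_trans a1.
have c0 : 0 < 2 * a by apply: mulr_gt0.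
have sN0 : 0 <= Num.sqrt N%:R :> R by exact: sqrtr_ge0.
have h k : (k < N)%N ->
    profile N k `^ a <= (2 * a) `^ a * 2 * Num.sqrt N%:R * (Num.sqrt k.+1%:R)^-1.
  move=> kN; have y1 := profile_arg_ge1 kN; have y0 := lt_le_trans ltr01 y1.
  have -> : (2 * a) `^ a * 2 * Num.sqrt N%:R * (Num.sqrt k.+1%:R)^-1 =
      (2 * a) `^ a * (2 * Num.sqrt (N%:R / k.+1%:R)).
    by rewrite sqrtrM// sqrtrV// !mulrA.
  have h1 : profile N k <= 2 * a * expR (profile N k / (2 * a)).
    rewrite -ler_pdivrMl// mulrC; apply: le_trans (expR_ge1Dx _); rewrite lerDr//.
  apply: (@le_trans _ _ ((2 * a * expR (profile N k / (2 * a))) `^ a)).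
    by rewrite ge0_ler_powR ?nnegrE ?profile_ge0 ?(ltW a0)// mulr_ge0 ?expR_ge0// ltW.
  rewrite powRM ?expR_ge0 ?(ltW c0)// ler_wpM2l ?powR_ge0//.
  rewrite -expRM (_ : _ / _ * a = 2^-1 + ln (N%:R / k.+1%:R) * 2^-1); last first.
    by rewrite /profile; field; rewrite gt_eqF.
  rewrite expRD expRM lnK ?posrE// powR12_sqrt ?(ltW y0)//.
  by rewrite ler_wpM2r ?sqrtr_ge0// expR_half_le2.
apply: (@le_trans _ _ (\sum_(k < N)
    ((2 * a) `^ a * 2 * Num.sqrt N%:R * (Num.sqrt k.+1%:R)^-1))).
  by apply: ler_sum => k _; exact: h.
rewrite -mulr_sumr.
apply: le_trans (ler_wpM2l _ (sum_inv_sqrt_le N)) _.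
  by rewrite !mulr_ge0 ?powR_ge0.
rewrite (_ : _ * (2 * _) = (2 * a) `^ a * 4 * (Num.sqrt N%:R) ^+ 2); last by ring.
rewrite sqr_sqrtr// ler_wpM2r//.
rewrite (_ : 8 * a = 4 * (2 * a)); last by ring.
rewrite [in leRHS]powRM ?(ltW c0)// mulrC ler_wpM2r ?powR_ge0//.
by rewrite -[leLHS]powRr1// ler_powR// ler1n.
Qed.

Lemma powR_add_le (a x y : R) : 0 <= a -> 0 <= x -> 0 <= y ->
  (x + y) `^ a <= (2 * x) `^ a + (2 * y) `^ a.
Proof.
move=> a0; wlog xy : x y / x <= y => [H x0 y0|x0 y0].
  have [xy|/ltW yx] := leP x y; first exact: H.
  by rewrite addrC [leRHS]addrC; exact: H.
apply: (@le_trans _ _ ((2 * y) `^ a)); last by rewrite lerDr powR_ge0.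
by rewrite ge0_ler_powR ?nnegrE ?addr_ge0 ?mulr_ge0//; lra.
Qed.

(** Otherwise v is weakly majorized by L profile with an extra X/4 N^(1/a) added to
the first term, and the sum of the a-th powers of that sequence is at most
X^a N, each of its two parts contributing at most half. *)
Lemma large_subset_sum (a X L : R) N (v : 'I_N -> R) : 1 <= a -> (0 < N)%N ->
  0 < X -> 0 <= L -> (forall i, 0 <= v i) ->
  \sum_(k < N) (2 * L * profile N k) `^ a <= (X / 2) `^ a * N%:R ->
  X `^ a * N%:R < \sum_i v i `^ a ->
  exists2 A : {set 'I_N}, A != finset.set0 &
    X / 4 * N%:R `^ a^-1 + L * \sum_(k < #|A|) profile N k < \sum_(i in A) v i.
Proof.
move=> a1 N0 X0 L0 v0 hL; apply: contraPP => hA; apply/negP; rewrite -leNgt.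
have a0 : 0 < a by apply: lt_le_trans a1.
have NR0 : 0 < N%:R :> R by rewrite ltr0n.
pose r := X / 4 * N%:R `^ a^-1.
have r0 : 0 <= r by rewrite mulr_ge0 ?powR_ge0 ?divr_ge0// ltW.
(* The extra r sits in the first term: it enters every partial sum but only
   one a-th power. *)
pose w k : R := L * profile N k + (k == 0%N)%:R * r.
have w0 k : (k < N)%N -> 0 <= w k.
  by move=> kN; apply: addr_ge0; apply: mulr_ge0; rewrite ?profile_ge0 ?ler0n.
apply: (@le_trans _ _ (\sum_(k < N) w k `^ a)).
  apply: majorized_sum_powR => // A.
  have [->|A0] := eqVneq A finset.set0.
    by rewrite big_set0 cards0 big_ord0.
  have : ~ (r + L * \sum_(k < #|A|) profile N k < \sum_(i in A) v i).
    by move=> h; apply: hA; exists A.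
  move/negP; rewrite -leNgt => /le_trans; apply.
  rewrite /w [leRHS]big_split/= -[X in _ <= X + _]mulr_sumr addrC lerD2l.
  have : (0 < #|A|)%N by rewrite card_gt0.
  case: #|A| => // m _; rewrite big_ord_recl/= mul1r lerDl sumr_ge0// => i _.
  by rewrite mulr_ge0.
case: N N0 v v0 hL hA NR0 @r r0 @w w0 => // N _ v v0 hL hA NR0 r r0 w w0.
apply: (@le_trans _ _ (\sum_(k < N.+1) (2 * L * profile N.+1 k) `^ a + (2 * r) `^ a)).
  rewrite big_ord_recl [X in _ <= X + _]big_ord_recl addrAC.
  apply: lerD; last first.
    apply: ler_sum => k _.
    have p0 := @profile_ge0 N.+1 _ (ltn_ord (lift ord0 k)).
    rewrite /w/= mul0r addr0 ge0_ler_powR ?nnegrE ?mulr_ge0 ?(ltW a0)//.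
    by rewrite -mulrA ler_peMl ?mulr_ge0// ler1n.
  rewrite /w/= mul1r -mulrA; apply: powR_add_le => //; first exact: ltW.
  by rewrite mulr_ge0 ?profile_ge0.
apply: le_trans (lerD hL (lexx _)) _.
have -> : 2 * r = X / 2 * N.+1%:R `^ a^-1 by rewrite /r; field.
rewrite [X in _ + X]powRM ?divr_ge0 ?powR_ge0 ?(ltW X0)//.
rewrite -powRrM mulVf ?gt_eqF// powRr1 ?(ltW NR0)// -mulrDl ler_wpM2r ?(ltW NR0)//.
rewrite powRM ?invr_ge0 ?(ltW X0)// -mulrDr ler_piMr ?powR_ge0//.
have : 2^-1 `^ a <= 2^-1 :> R.
  by rewrite -[leRHS]powRr1 ?invr_ge0// ger_powR// ?invr_gt0//= ?invf_le1 ?ler1n// ltr0n.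
lra.
Qed.

(** The subsets of size m contribute C(N, m) m!/(eN)^m, which is at most 1. *)
Lemma sum_subsets_profile_le N :
  \sum_(A : {set 'I_N}) expR (- \sum_(k < #|A|) profile N k) <= N.+1%:R.
Proof.
rewrite (partition_big (fun A : {set 'I_N} => inord #|A| : 'I_N.+1) xpredT)//=.
apply: (@le_trans _ _ (\sum_(m < N.+1) 1)); last by rewrite sumr_const card_ord.
apply: ler_sum => m _.
have cA (A : {set 'I_N}) : (inord #|A| == m) = (#|A| == m :> nat).
  by rewrite -val_eqE/= inordK// ltnS -[leqRHS]card_ord max_card.
rewrite (eq_bigl (fun A : {set 'I_N} => #|A| == m)); last by move=> A; rewrite cA.
rewrite (eq_bigr (fun=> expR (- \sum_(k < m) profile N k))); last first.
  by move=> A /eqP ->.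
rewrite sumr_const -[X in _ *+ X](_ : 'C(N, m) = _); last first.
  have := card_draws 'I_N m; rewrite card_ord => <-.
  by apply: eq_card => A; rewrite inE.
have mN : (m <= N)%N by rewrite -ltnS.
elim: (m : nat) mN => [|k IH] kN; first by rewrite big_ord0 oppr0 expR0 bin0.
apply: le_trans (IH (ltnW kN)).
rewrite big_ord_recr/= opprD expRD -mulr_natr -[leRHS]mulr_natr -mulrA.
rewrite ler_wpM2l ?expR_ge0//.
have -> : expR (- profile N k) = expR (- 1) * (k.+1%:R / N%:R) :> R.
  rewrite /profile opprD expRD; congr (_ * _).
  by rewrite expRN lnK ?invf_div// posrE divr_gt0// ltr0n; exact: leq_ltn_trans kN.
have e1 : expR (- 1) <= 1 :> R by rewrite -[leRHS]expR0 ler_expR; lra.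
apply: (@le_trans _ _ (1 * (k.+1%:R / N%:R) * 'C(N, k.+1)%:R)).
  by rewrite ler_wpM2r// ler_wpM2r// divr_ge0.
rewrite mul1r mulrAC ler_pdivrMr; last by rewrite ltr0n; exact: leq_ltn_trans kN.
rewrite -!natrM ler_nat mul_bin_left mulnC leq_mul2l leq_subr orbT//.
Qed.
End profile.

(** * Exponential moments of the surface measure *)
Section product_weights.
Context {R : realType}.
Local Notation mR := (measurableTypeR R).
Local Notation mu := (@lebesgue_measure R).
Local Notation leb n := (@lebesgue_tuple R n).

Lemma measurable_prod_tnth n (k : nat -> R -> R) :
  (forall i, measurable_fun setT (k i)) ->
  measurable_fun setT (fun y : n.-tuple mR => \prod_(i < n) k i (tnth y i)).
Proof.
move=> mk; apply: measurable_prod => i _.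
exact: (measurableT_comp (mk i) (measurable_tnth i)).
Qed.

Local Open Scope ereal_scope.

Lemma integral_prod_tnth n (k : nat -> R -> R) :
  (forall i, measurable_fun setT (k i)) -> (forall i x, (0 <= k i x)%R) ->
  \int[leb n]_y (\prod_(i < n) k i (tnth y i))%:E =
  \prod_(i < n) \int[mu]_x (k i x)%:E.
Proof.
move=> mk k0; elim: n k mk k0 => [|n IH] k mk k0.
  rewrite big_ord0 /=; under eq_integral do rewrite big_ord0.
  by rewrite integral_cst// mul1e /= diracT.
have P0 (m : nat) (l : nat -> R -> R) (y : m.-tuple mR) : (forall i x, (0 <= l i x)%R) ->
    (0 <= \prod_(i < m) l i (tnth y i))%R.
  by move=> l0; apply: prodr_ge0.
rewrite tuple_tonelli_head; last 2 first.
- by apply/measurable_EFinP; exact: measurable_prod_tnth.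
- by move=> y; rewrite lee_fin P0.
rewrite big_ord_recl.
have I0 : 0 <= \prod_(i < n) \int[mu]_x (k i.+1 x)%:E.
  by apply: prode_ge0 => i _; apply: integral_ge0 => x _; rewrite lee_fin.
rewrite -ge0_integralZr//; last 2 first.
- by apply/measurable_EFinP; exact: mk.
- by move=> x _; rewrite lee_fin k0.
apply: eq_integral => x _.
rewrite -(IH (fun i => k i.+1))//.
have P1 (y : n.-tuple mR) : 0 <= (\prod_(i < n) k i.+1 (tnth y i))%:E.
  by rewrite lee_fin; apply: (P0 n (fun i => k i.+1)) => i; exact: k0.
have mP : measurable_fun setT
    (fun y : n.-tuple mR => (\prod_(i < n) k i.+1 (tnth y i))%:E).
  by apply/measurable_EFinP; exact: (@measurable_prod_tnth n (fun i => k i.+1)).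
rewrite -(ge0_integralZl_EFin _ measurableT (fun y _ => P1 y) mP (k0 _ _)).
apply: eq_integral => y _; rewrite -EFinM big_ord_recl; congr (_ * _)%:E.
by apply: eq_bigr => i _; rewrite tnth_cons_pairS.
Qed.
End product_weights.

Section weighted_area.
Context {R : realType}.
Local Notation mR := (measurableTypeR R).
Local Notation mu := (@lebesgue_measure R).
Local Notation leb n := (@lebesgue_tuple R n).
Variable p : R.
Hypothesis p1 : 1 <= p.
Local Notation psum := (power_sum p).
Local Notation simplex := (simplex p).
Local Notation density := (surface_density p).

Let p0 : 0 < p. Proof. exact: lt_le_trans p1. Qed.

(** The one-dimensional factor of the product measures with which the surface
measure is compared. For c = -1/p the N-fold product of these factors is constant on
the sphere. *)
Definition line_weight (c x : R) : R :=
  \1_(`]0, +oo[%classic : set R) x * expR (c * x `^ p).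

Definition weight_mass (c : R) : \bar R :=
  (\int[mu]_x (line_weight c x)%:E)%E.

Lemma line_weight_ge0 c x : 0 <= line_weight c x.
Proof. by rewrite mulr_ge0 ?expR_ge0// indicE ler0n. Qed.

Lemma line_weight_gt0 c x : 0 < x -> line_weight c x = expR (c * x `^ p).
Proof.
by move=> x0; rewrite /line_weight indicE mem_set/= ?in_itv/= ?x0// mul1r.
Qed.

Lemma measurable_expR_powR (c : R) :
  measurable_fun setT (fun x : mR => expR (c * x `^ p)).
Proof.
apply: (measurableT_comp (@measurable_expR R)).
by apply: measurable_funM => //; exact: measurable_powR.
Qed.

Lemma measurable_line_weight c : measurable_fun setT (line_weight c).
Proof.
apply: measurable_funM; last exact: measurable_expR_powR.
by apply: measurable_indic.
Qed.

Local Open Scope ereal_scope.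

Lemma weight_mass_ge0 c : 0 <= weight_mass c.
Proof. by apply: integral_ge0 => x _; rewrite lee_fin line_weight_ge0. Qed.

Lemma weight_massE c :
  weight_mass c = \int[mu]_(x in `]0%R, +oo[) (expR (c * x `^ p))%:E.
Proof.
rewrite [RHS]integral_mkcond; apply: eq_integral => x _.
rewrite patchE /line_weight indicE.
by case: (x \in _); rewrite ?mul1r ?mul0r.
Qed.

Lemma weight_mass_le4 c : (c <= - (2 * p)^-1)%R -> weight_mass c <= 4%:E.
Proof.
move=> hc; apply: le_trans (integral_expR_powR_le p1).
rewrite weight_massE; apply: nonneg_le_integral => x _; rewrite lee_fin ?expR_ge0//.
by rewrite ler_expR -mulNr ler_wpM2r ?powR_ge0.
Qed.

Lemma weight_mass_ge c : (- p^-1 <= c)%R -> (expR (- 1))%:E <= weight_mass c.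
Proof.
move=> hc; rewrite weight_massE.
apply: (@le_trans _ _ (\int[mu]_(x in `]0%R, 1%R]) (expR (- 1))%:E)).
  by rewrite integral_cst_bnd// subr0 mule1.
apply: nonneg_le_integral_dom => x; [by rewrite lee_fin expR_ge0..| |];
  rewrite /= !in_itv/= andbT => /andP[x0 x1]; last by rewrite x0.
move=> _; rewrite lee_fin ler_expR.
have h1 : (x `^ p <= 1)%R.
  have <- : (1 `^ p = 1 :> R)%R by rewrite powR1.
  by rewrite ge0_ler_powR ?nnegrE ?(ltW p0) ?(ltW x0).
have h2 : (p^-1 <= 1)%R by rewrite invf_le1.
have h0 : (0 <= x `^ p)%R by rewrite powR_ge0.
have h3 : (0 <= p^-1)%R by rewrite invr_ge0 ltW.
apply: (@le_trans _ _ (- p^-1 * x `^ p)%R); last by rewrite ler_wpM2r.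
by rewrite mulNr lerN2 -[leRHS]mulr1 ler_pM.
Qed.

Lemma weight_mass_fin_num c : (c <= - (2 * p)^-1)%R -> weight_mass c \is a fin_num.
Proof.
move=> /weight_mass_le4 h; rewrite ge0_fin_numE ?weight_mass_ge0//.
by apply: le_lt_trans h _; rewrite ltry.
Qed.

Lemma integral_prod_weight n (c : nat -> R) :
  \int[leb n]_y (\prod_(i < n) line_weight (c i) (tnth y i))%:E =
  \prod_(i < n) weight_mass (c i).
Proof.
apply: (@integral_prod_tnth _ n (fun i => line_weight (c i))).
  by move=> i; exact: measurable_line_weight.
by move=> i x; exact: line_weight_ge0.
Qed.

(** The linear form with coefficients l in the p-th powers of the coordinates of the
point of the sphere above y; the last p-th power is M minus the others. *)
Definition exponent n (l : nat -> R) (M : R) (y : n.-tuple R) : R :=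
  (\sum_(i < n) l i * tnth y i `^ p + l n * (M - psum y))%R.

Lemma exponent_cons n l M (y : n.-tuple mR) (x : R) :
  exponent l M (cons_pair (y, x)) =
  (l 0%N * x `^ p + exponent (fun i => l i.+1) (M - x `^ p) y)%R.
Proof.
rewrite /exponent power_sum_cons opprD (addrA M) addrA; congr (_ + _)%R.
rewrite big_ord_recl tnth_cons_pair0; congr (_ + _)%R.
by apply: eq_bigr => i _; rewrite tnth_cons_pairS.
Qed.

Lemma measurable_exponent n l M :
  measurable_fun setT (fun y : n.-tuple mR => exponent l M y).
Proof.
apply: measurable_funD.
  apply: measurable_sum => i; apply: measurable_funM => //.
  exact: measurable_tnth_powR.
apply: measurable_funM => //; apply: measurable_funB => //; exact: measurable_power_sum.
Qed.

(** This absorbs the length of a fibre into half of the exponential weight. *)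
Let root_le_expR (D : R) : (0 < D)%R ->
  (D `^ p^-1 <= expR 2 * expR (D / (2 * p)))%R.
Proof.
move=> D0; have pp : (0 < 2 * p)%R by apply: mulr_gt0.
have ip : (0 <= p^-1)%R by rewrite invr_ge0 ltW.
have h u : (0 <= u)%R -> (u `^ p^-1 <= expR (u / p))%R.
  move=> u0; rewrite expRM ge0_ler_powR ?nnegrE ?expR_ge0//.
  by apply: le_trans (expR_ge1Dx _); rewrite lerDr.
rewrite (_ : D = 2 * p * (D / (2 * p)))%R; last by field; rewrite gt_eqF.
rewrite powRM ?divr_ge0 ?(ltW pp) ?(ltW D0)//.
rewrite [(2 * p * (D / (2 * p)) / (2 * p))%R](_ : _ = D / (2 * p))%R; last first.
  by field; rewrite gt_eqF.
apply: ler_pM; rewrite ?powR_ge0//.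
  apply: le_trans (h _ (ltW pp)) _.
  by rewrite ler_expR mulfK ?gt_eqF.
apply: le_trans (h _ _) _; first by rewrite divr_ge0 ?(ltW D0) ?(ltW pp).
rewrite ler_expR ler_pdivrMr// ler_peMr// divr_ge0 ?(ltW D0) ?(ltW pp)//.
Qed.

(** On the fibre above y, of length (M - sum)^(1/p), the exponent grows by at most
(M - sum)/(2p), and the slope integrates to at most this length. By
root_le_expR the total is at most a constant times exp((M - sum)/p), which
factorizes over the coordinates of y; the constraint on y can then be dropped. *)
Let side_le n (l : nat -> R) (M : R) :
  (forall i, 0 <= l i <= (2 * p)^-1)%R ->
  \int[leb n]_(y in simplex M) \int[mu]_(x in `]0%R, ((M - psum y) `^ p^-1)%R[)
    (expR (exponent l M (cons_pair (y, x))) *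
      (x `^ (p - 1) * (M - psum y - x `^ p) `^ (p^-1 - 1)))%:E <=
  (expR 2 * expR (M / p))%:E * \prod_(i < n) weight_mass (l i.+1 - p^-1).
Proof.
move=> hl; rewrite -(integral_prod_weight n (fun i => l i.+1 - p^-1)%R).
have P0 (y : n.-tuple mR) :
    0 <= (\prod_(i < n) line_weight (l i.+1 - p^-1) (tnth y i))%:E.
  by rewrite lee_fin prodr_ge0// => i _; exact: line_weight_ge0.
have mP : measurable_fun setT (fun y : n.-tuple mR =>
    (\prod_(i < n) line_weight (l i.+1 - p^-1) (tnth y i))%:E).
  apply/measurable_EFinP.
  apply: (@measurable_prod_tnth _ n (fun i => line_weight (l i.+1 - p^-1))).
  by move=> i; exact: measurable_line_weight.
have K0 : (0 <= expR 2 * expR (M / p))%R by rewrite mulr_ge0 ?expR_ge0.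
rewrite -(ge0_integralZl_EFin _ measurableT (fun y _ => P0 y) mP K0).
apply: nonneg_le_integral_dom => [y _|y _|y [y0 yM] _|y _ []//].
- apply: integral_ge0 => x _.
  by rewrite lee_fin mulr_ge0 ?expR_ge0// mulr_ge0 ?powR_ge0.
- by apply: mule_ge0; [rewrite lee_fin|exact: P0].
set D := (M - psum y)%R; have D0 : (0 < D)%R by rewrite subr_gt0.
pose e := (\sum_(i < n) l i.+1 * tnth y i `^ p)%R.
pose W x : \bar R := (x `^ (p - 1) * (D - x `^ p) `^ (p^-1 - 1))%:E.
have W0 x : 0 <= W x by rewrite lee_fin mulr_ge0 ?powR_ge0.
have mW : measurable_fun (`]0%R, (D `^ p^-1)%R[%classic : set mR) W.
  apply: measurable_funTS; apply/measurable_EFinP; apply: measurable_funM.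
    exact: measurable_powR.
  apply: (measurableT_comp (measurable_powR _)).
  by apply: measurable_funB => //; exact: measurable_powR.
apply: (@le_trans _ _ (\int[mu]_(x in `]0%R, (D `^ p^-1)%R[)
    ((expR (e + D / (2 * p)))%:E * W x))).
  apply: nonneg_le_integral => x; rewrite /= in_itv/= => /andP[x0 xD].
    by rewrite lee_fin mulr_ge0 ?expR_ge0// mulr_ge0 ?powR_ge0.
  rewrite /W -EFinM lee_fin ler_wpM2r ?mulr_ge0 ?powR_ge0//.
  rewrite ler_expR exponent_cons /exponent -/e addrCA lerD2l.
  have -> : (M - x `^ p - psum y = D - x `^ p)%R by rewrite /D addrAC.
  have xp : (x `^ p <= D)%R.
    have -> : D = ((D `^ p^-1) `^ p)%R.
      by rewrite -powRrM mulVf ?gt_eqF// powRr1// ltW.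
    by rewrite ge0_ler_powR ?nnegrE ?powR_ge0 ?(ltW p0) ?(ltW x0) ?(ltW xD).
  have -> : (D / (2 * p) = (2 * p)^-1 * x `^ p + (2 * p)^-1 * (D - x `^ p))%R by ring.
  have /andP[_ h1] := hl 0%N; have /andP[_ h2] := hl n.+1.
  by apply: lerD; apply: ler_wpM2r; rewrite ?powR_ge0 ?subr_ge0.
rewrite (ge0_integralZl_EFin _ _ _ mW) ?expR_ge0//.
apply: le_trans (lee_wpmul2l _ (integral_quadrant_weight_le p0 D0)) _.
  by rewrite lee_fin expR_ge0.
rewrite -!EFinM lee_fin.
have -> : (\prod_(i < n) line_weight (l i.+1 - p^-1) (tnth y i) =
    expR (e - psum y / p))%R.
  rewrite (eq_bigr (fun i : 'I_n => expR ((l i.+1 - p^-1) * tnth y i `^ p))); last first.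
    by move=> i _; rewrite line_weight_gt0.
  rewrite -expR_sum; congr expR.
  rewrite /e /power_sum mulr_suml -sumrB; apply: eq_bigr => i _; ring.
apply: le_trans (ler_wpM2l (expR_ge0 _) (root_le_expR D0)) _.
rewrite mulrCA -[leRHS]mulrA -!expRD le_eqVlt; apply/orP; left; apply/eqP.
by congr expR; rewrite /D; field; rewrite gt_eqF.
Qed.

(** Induction on the dimension. Slicing reproduces the left-hand side one dimension
lower and leaves a side term, which side_le bounds by the same product; the
side terms add up to a loss that is only linear in n. *)
Theorem weighted_area_le n (l : nat -> R) (M : R) :
  (forall i, 0 <= l i <= (2 * p)^-1)%R ->
  \int[leb n]_(y in simplex M) (expR (exponent l M y) * density M y)%:E <=
  ((1 + n%:R * expR 3) * expR (M / p))%:E * \prod_(i < n) weight_mass (l i - p^-1).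
Proof.
have P0 m (k : nat -> R) : 0 <= \prod_(i < m) weight_mass (k i).
  by apply: prode_ge0 => i _; exact: weight_mass_ge0.
have d0 m (k : nat -> R) M' (y : m.-tuple R) :
    0 <= (expR (exponent k M' y) * density M' y)%:E.
  by rewrite lee_fin mulr_ge0 ?expR_ge0 ?surface_density_ge0.
have b0 (m : nat) : (0 <= 1 + m%:R * expR 3 :> R)%R.
  by rewrite addr_ge0// mulr_ge0 ?expR_ge0.
have [M0|M0] := leP M 0%R.
  move=> hl; rewrite simplex_le0// integral_set0.
  apply: mule_ge0; last exact: (P0 n (fun i => l i - p^-1)%R).
  by rewrite lee_fin mulr_ge0 ?expR_ge0.
elim: n l M M0 => [|n IH] l M M0 hl.
  rewrite big_ord0 mule1 mul0r addr0 mul1r /= integral_dirac//; last first.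
  - apply: measurable_funTS; apply/measurable_EFinP; apply: measurable_funM.
      apply: (measurableT_comp (@measurable_expR R)); exact: measurable_exponent.
    exact: measurable_surface_density.
  - exact: measurable_simplex.
  rewrite diracE mem_set; last by split=> [[]//|]; rewrite /power_sum big_ord0.
  rewrite mul1e lee_fin /surface_density /exponent /power_sum !big_ord0 addr0 sqrtr1 mulr1.
  rewrite add0r subr0 ler_expR mulrC ler_wpM2l ?(ltW M0)//.
  have /andP[_ /le_trans] := hl 0%N; apply.
  by rewrite lef_pV2 ?posrE ?mulr_gt0// ler_peMl ?(ltW p0)// ler1n.
pose g (z : n.+1.-tuple mR) := expR (exponent l M z).
have mg : measurable_fun setT g.
  by apply: (measurableT_comp (@measurable_expR R)); exact: measurable_exponent.
have g0 z : (0 <= g z)%R by exact: expR_ge0.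
apply: le_trans (surface_density_step_le p0 M mg g0) _.
set P := \prod_(i < n) weight_mass (l i.+1 - p^-1).
have PP0 : 0 <= P by exact: (P0 n (fun i => l i.+1 - p^-1)%R).
rewrite big_ord_recl -/P.
set Z := weight_mass _.
have Z0 : 0 <= Z by exact: weight_mass_ge0.
have Z1 : (expR (- 1))%:E <= Z.
  by apply: weight_mass_ge; rewrite -[leLHS]add0r lerD2r; have /andP[] := hl 0%N.
pose b : R := (1 + n%:R * expR 3)%R.
have bb0 : (0 <= b)%R by exact: b0.
apply: (@le_trans _ _ ((b * expR (M / p))%:E * (Z * P) +
    (expR 3 * expR (M / p))%:E * (Z * P))); last first.
  rewrite -ge0_muleDl ?lee_fin ?mulr_ge0 ?expR_ge0// -EFinD -mulrDl.
  by rewrite (_ : b + expR 3 = 1 + n.+1%:R * expR 3)%R// /b -natr1; ring.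
apply: leeD; last first.
  apply: le_trans (side_le n M hl) _; rewrite -/P muleA.
  apply: lee_wpmul2r => //.
  apply: (@le_trans _ _ ((expR 3 * expR (M / p))%:E * (expR (- 1))%:E)).
    rewrite -EFinM lee_fin [leRHS]mulrAC -(expRD 3) ler_wpM2r ?expR_ge0// ler_expR; lra.
  by apply: lee_wpmul2l => //; rewrite lee_fin mulr_ge0 ?expR_ge0.
have hl' i : (0 <= l i.+1 <= (2 * p)^-1)%R by exact: hl.
have c0 : 0 <= (b * expR (M / p))%:E * P.
  by apply: mule_ge0 => //; rewrite lee_fin mulr_ge0 ?expR_ge0.
rewrite [X in _ <= _ * X]muleC muleA /Z weight_massE -ge0_integralZl//; last first.
  by apply: measurable_funTS; apply/measurable_EFinP; exact: measurable_expR_powR.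
apply: nonneg_le_integral => x; rewrite /= in_itv/= andbT => x0.
  apply: integral_ge0 => y _.
  by rewrite lee_fin mulr_ge0 ?expR_ge0 ?surface_density_ge0.
have [xM|xM] := leP (M - x `^ p)%R 0%R.
  rewrite simplex_le0// integral_set0; apply: mule_ge0; first exact: c0.
  by rewrite lee_fin expR_ge0.
apply: (@le_trans _ _ ((expR (l 0%N * x `^ p))%:E *
  \int[leb n]_(y in simplex (M - x `^ p)%R)
    (expR (exponent (fun i => l i.+1) (M - x `^ p) y) * density (M - x `^ p) y)%:E)).
  have mI : measurable_fun (simplex (M - x `^ p) : set (n.-tuple mR))
      (fun y => (expR (exponent (fun i => l i.+1) (M - x `^ p) y) *
        density (M - x `^ p) y)%:E).
    apply: measurable_funTS; apply/measurable_EFinP; apply: measurable_funM.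
      apply: (measurableT_comp (@measurable_expR R)); exact: measurable_exponent.
    exact: measurable_surface_density.
  rewrite -(ge0_integralZl_EFin _ (@measurable_simplex R p n _)
    (fun y _ => d0 n (fun i => l i.+1) _ y) mI (expR_ge0 _)).
  apply: nonneg_le_integral => y _.
    by rewrite lee_fin mulr_ge0 ?expR_ge0 ?surface_density_ge0.
  by rewrite /g exponent_cons expRD -EFinM -mulrA.
apply: le_trans (lee_wpmul2l _ (IH _ _ xM hl')) _; first by rewrite lee_fin expR_ge0.
rewrite -/P -/b muleA [leRHS]muleAC; apply: lee_wpmul2r => //.
rewrite -!EFinM lee_fin [leRHS]mulrAC mulrC -!mulrA ler_wpM2l//.
rewrite -!expRD le_eqVlt; apply/orP; left; apply/eqP; congr expR.
by field; rewrite gt_eqF.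
Qed.
End weighted_area.

(** * The normalizing constant *)
Section volume_lower_bound.
Context {R : realType}.
Local Notation mR := (measurableTypeR R).
Local Notation leb n := (@lebesgue_tuple R n).
Variable p : R.
Hypothesis p1 : 1 <= p.
Local Notation psum := (power_sum p).
Local Notation simplex := (simplex p).
Local Notation weight := (line_weight p).

Let p0 : 0 < p. Proof. exact: lt_le_trans p1. Qed.

(** The mass of exp(-x^p/p) on the half-line. *)
Definition base_mass : R := fine (weight_mass p (- p^-1)).
(** The mass after the tilt by exp(x^p/(2p)) used in exponential moments. *)
Definition tilted_mass : R := fine (weight_mass p (- (2 * p)^-1)).

Let half_le : - p^-1 <= - (2 * p)^-1.
Proof. by rewrite lerN2 lef_pV2 ?posrE ?mulr_gt0// ler_peMl ?(ltW p0)// ler1n. Qed.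

Lemma base_massE : weight_mass p (- p^-1) = base_mass%:E.
Proof. by rewrite fineK// weight_mass_fin_num. Qed.

Lemma tilted_massE : weight_mass p (- (2 * p)^-1) = tilted_mass%:E.
Proof. by rewrite fineK// weight_mass_fin_num. Qed.

Lemma base_mass_ge : expR (- 1) <= base_mass.
Proof. by rewrite -lee_fin -base_massE weight_mass_ge. Qed.

Lemma base_mass_gt0 : 0 < base_mass.
Proof. by apply: lt_le_trans base_mass_ge; exact: expR_gt0. Qed.

Lemma tilted_mass_ge0 : 0 <= tilted_mass.
Proof. by rewrite -lee_fin -tilted_massE weight_mass_ge0. Qed.

Lemma tilted_mass_le : tilted_mass <= expR 3 * base_mass.
Proof.
apply: (@le_trans _ _ (expR 3 * expR (- 1))); last first.
  by rewrite ler_wpM2l ?expR_ge0// base_mass_ge.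
apply: (@le_trans _ _ 4).
  by rewrite -lee_fin -tilted_massE weight_mass_le4.
rewrite -expRD (_ : 3 + - 1 = 1 * 2%:R)%R; last by lra.
rewrite expRM_natr (_ : 4 = 2 ^+ 2); last by ring.
rewrite ler_sqr ?nnegrE ?expR_ge0//.
by apply: le_trans (expR_ge1Dx _); lra.
Qed.

Let prod_weight_orthant n c (y : n.-tuple R) : (forall i, 0 < tnth y i) ->
  \prod_(i < n) weight c (tnth y i) = expR (c * psum y).
Proof.
move=> y0; rewrite /power_sum mulr_sumr expR_sum; apply: eq_bigr => i _.
exact: line_weight_gt0.
Qed.

Let prod_weight_ge0 n c (y : n.-tuple R) :
  0 <= \prod_(i < n) weight c (tnth y i).
Proof. by rewrite prodr_ge0// => i _; exact: line_weight_ge0. Qed.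

(** The product density is cut at the integer values of the sum of the p-th powers;
beyond J, half of the exponent is kept as a factor exp(-J/(2p)). *)
Let shell_bound n J (y : n.-tuple R) :
  \prod_(i < n) weight (- p^-1) (tnth y i) <=
  \sum_(j < J) expR (- (j%:R / p)) * \1_(simplex j.+1%:R) y +
  expR (- (J%:R / (2 * p))) * \prod_(i < n) weight (- (2 * p)^-1) (tnth y i).
Proof.
have s0 (j : 'I_J) : 0 <= expR (- (j%:R / p)) * \1_(simplex j.+1%:R) y.
  by rewrite mulr_ge0 ?expR_ge0// indicE ler0n.
(* Off the open orthant the left-hand side vanishes. *)
have [y0|] := pselect (forall i, 0 < tnth y i); last first.
  move=> /existsNP[i /negP]; rewrite -leNgt => yi.
  rewrite [leLHS](bigD1 i)//= {1}/line_weight indicE.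
  rewrite memNset ?mul0r; last by rewrite /= in_itv/= andbT ltNge yi.
  by apply: addr_ge0; [exact: sumr_ge0|rewrite mulr_ge0 ?expR_ge0 ?prod_weight_ge0].
rewrite !prod_weight_orthant//.
have S0 := power_sum_ge0 p y.
have [SJ|JS] := ltP (psum y) J%:R.
  have /andP[h1 h2] := truncn_itv S0.
  have jJ : (Num.truncn (psum y) < J)%N.
    by rewrite -(ltr_nat R); exact: le_lt_trans h1 SJ.
  apply: (@le_trans _ _
    (\sum_(j < J) expR (- (j%:R / p)) * \1_(simplex j.+1%:R) y)); last first.
    by rewrite lerDl mulr_ge0 ?expR_ge0.
  rewrite (bigD1 (Ordinal jJ))//=.
  apply: (@le_trans _ _ (expR (- ((Num.truncn (psum y))%:R / p)) * 1)); last first.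
    rewrite indicE mem_set ?lerDl ?sumr_ge0//.
  by rewrite mulr1 ler_expR mulNr lerN2 mulrC ler_wpM2l ?invr_ge0 ?(ltW p0).
apply: (@le_trans _ _
  (expR (- (J%:R / (2 * p))) * expR (- (2 * p)^-1 * psum y))); last first.
  by rewrite lerDr sumr_ge0.
rewrite -expRD ler_expR.
have : J%:R / (2 * p) <= psum y / (2 * p).
  by rewrite ler_wpM2r// invr_ge0 mulr_ge0 ?(ltW p0).
have -> : - p^-1 * psum y = - (psum y / (2 * p)) - psum y / (2 * p).
  by field; rewrite gt_eqF.
by rewrite mulNr [_^-1 * psum y]mulrC; lra.
Qed.

(** The function x^n exp(-x) is maximal at x = n. *)
Let power_exp_max n (x : R) : (0 < n)%N -> 0 < x ->
  x `^ (n%:R / p) * expR (- (x / p)) <= n%:R `^ (n%:R / p) * expR (- (n%:R / p)).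
Proof.
move=> n0 x0; have N0 : 0 < n%:R :> R by rewrite ltr0n.
have h : x <= n%:R * expR (x / n%:R - 1).
  rewrite -ler_pdivrMl// mulrC; apply: le_trans (expR_ge1Dx _); lra.
have np0 : 0 <= n%:R / p by rewrite divr_ge0// ltW.
apply: (@le_trans _ _ ((n%:R * expR (x / n%:R - 1)) `^ (n%:R / p) * expR (- (x / p)))).
  apply: ler_wpM2r; first exact: expR_ge0.
  apply: ge0_ler_powR => //; rewrite nnegrE; first exact: ltW.
  by apply: mulr_ge0 => //; exact: expR_ge0.
rewrite powRM ?expR_ge0// -mulrA ler_wpM2l ?powR_ge0//.
rewrite -expRM -expRD ler_expR le_eqVlt; apply/orP; left; apply/eqP.
by field; rewrite !gt_eqF.
Qed.

(** Integrate shell_bound. The last term is at most half of the left-hand side as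
soon as J exceeds 2p (3n + 1), by tilted_mass_le. The body of the j-th shell
is a dilate of the unit one, so that by power_exp_max no shell contributes more
than a constant times the one at radius n, and the number of shells is linear
in n. The volume is at most the area. *)
Lemma mass_le_area n : (0 < n)%N ->
  base_mass ^+ n * expR (n%:R / p) <=
  4 * (p * (6 * n%:R + 3)) * expR 1 * fine (area p n n.+1%:R).
Proof.
move=> n0.
have arith (a b c d : R) : a <= b * d + a / 2 -> b * d <= c * d -> a <= 2 * c * d.
  by lra.
pose J := (Num.truncn (2 * p * (3 * n%:R + 1))).+1.
have pn0 : 0 <= 2 * p * (3 * n%:R + 1) :> R.
  by rewrite !mulr_ge0 ?addr_ge0 ?mulr_ge0// ltW.
have J1 : 2 * p * (3 * n%:R + 1) <= J%:R :> R by exact/ltW/truncnS_gt.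
have J2 : J%:R <= p * (6 * n%:R + 3) :> R.
  rewrite /J -natr1; have /andP[h _] := truncn_itv pn0.
  apply: le_trans (lerD h (lexx 1)) _.
  have : 1 <= p by [].
  rewrite !mulrDr !mulr1; lra.
have half : expR (- (J%:R / (2 * p))) * tilted_mass ^+ n <= base_mass ^+ n / 2.
  have m0n : 0 <= base_mass ^+ n by rewrite exprn_ge0// ltW// base_mass_gt0.
  have e1 : tilted_mass ^+ n <= expR (n%:R * 3) * base_mass ^+ n.
    rewrite expRM_natl -exprMn lerXn2r ?nnegrE ?tilted_mass_ge0 ?tilted_mass_le//.
    by rewrite mulr_ge0 ?expR_ge0// ltW// base_mass_gt0.
  apply: le_trans (ler_wpM2l (expR_ge0 _) e1) _.
  rewrite mulrA [leRHS]mulrC ler_wpM2r// -expRD.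
  apply: (@le_trans _ _ (expR (- 1))).
    rewrite ler_expR.
    have : 3 * n%:R + 1 <= J%:R / (2 * p) by rewrite ler_pdivlMr ?mulr_gt0// mulrC.
    lra.
  rewrite expRN lef_pV2 ?posrE ?expR_gt0//.
  by apply: le_trans (expR_ge1Dx _); lra.
have v1 : volume p n 1 \is a fin_num.
  rewrite ge0_fin_numE; last exact: measure_ge0.
  by apply: le_lt_trans (volume_le_area p n 1) (area_lty p0 n).
set v := fine (volume p n 1).
have v0 : 0 <= v by rewrite fine_ge0// measure_ge0.
have shell : base_mass ^+ n <=
    \sum_(j < J) expR (- (j%:R / p)) * (j.+1%:R `^ (n%:R / p) * v) +
    expR (- (J%:R / (2 * p))) * tilted_mass ^+ n.
  rewrite -lee_fin.
  have -> : (base_mass ^+ n)%:E = (\int[leb n]_y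
      (\prod_(i < n) weight (- p^-1) (tnth y i))%:E)%E.
    rewrite (integral_prod_weight p n (fun=> - p^-1)) base_massE.
    by rewrite prodEFin prodr_const card_ord.
  have m1 c : measurable_fun setT (fun y : n.-tuple mR =>
      (\prod_(i < n) weight c (tnth y i))%:E).
    apply/measurable_EFinP; apply: (@measurable_prod_tnth _ n (fun=> weight c)).
    by move=> i; exact: measurable_line_weight.
  have ms j : measurable_fun setT (fun y : n.-tuple mR =>
      (expR (- (j%:R / p)) * \1_(simplex j.+1%:R) y)%:E).
    apply/measurable_EFinP; apply: measurable_funM => //.
    by apply: measurable_indic; exact: measurable_simplex.
  have i0 j (y : n.-tuple mR) : 0 <= expR (- (j%:R / p)) * \1_(simplex j.+1%:R) y.
    by rewrite mulr_ge0 ?expR_ge0// indicE ler0n.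
  apply: (@le_trans _ _ (\int[leb n]_y (\sum_(j < J)
      (expR (- (j%:R / p)) * \1_(simplex j.+1%:R) y)%:E +
      (expR (- (J%:R / (2 * p))))%:E *
      (\prod_(i < n) weight (- (2 * p)^-1) (tnth y i))%:E))%E).
    apply: nonneg_le_integral => y _; first by rewrite lee_fin prod_weight_ge0.
    by rewrite -EFinM sumEFin -EFinD lee_fin shell_bound.
  rewrite ge0_integralD//; last 4 first.
  - by move=> y _; apply: sume_ge0 => j _; rewrite lee_fin.
  - by apply: emeasurable_sum.
  - by move=> y _; rewrite -EFinM lee_fin mulr_ge0 ?expR_ge0.
  - by apply: emeasurable_funM.
  rewrite ge0_integral_sum//.
  have Pm c (y : n.-tuple mR) : (0 <= (\prod_(i < n) weight c (tnth y i))%:E)%E.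
    by rewrite lee_fin prod_weight_ge0.
  rewrite (ge0_integralZl_EFin _ measurableT (fun y _ => Pm _ y) (m1 _) (expR_ge0 _)).
  rewrite (integral_prod_weight p n (fun=> - (2 * p)^-1)) tilted_massE.
  rewrite prodEFin prodr_const card_ord.
  rewrite EFinD -EFinM; apply: leeD => //.
  rewrite -sumEFin; apply: lee_sum => j _.
  under eq_integral do rewrite EFinM.
  have mi : measurable_fun setT
      (fun y : n.-tuple mR => (\1_(simplex j.+1%:R : set (n.-tuple R)) y : R)%:E).
    by apply/measurable_EFinP; apply: measurable_indic; exact: measurable_simplex.
  have i1 (y : n.-tuple mR) :
      (0 <= (\1_(simplex j.+1%:R : set (n.-tuple R)) y : R)%:E)%E.
    by rewrite lee_fin indicE ler0n.
  rewrite (ge0_integralZl_EFin _ measurableT (fun y _ => i1 y) mi (expR_ge0 _)).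
  rewrite integral_indic//; last exact: measurable_simplex.
  rewrite setIT; apply: (@le_trans _ _
    ((expR (- (j%:R / p)))%:E * volume p n j.+1%:R)%E); first exact: lexx.
  by rewrite (volume_scale p0)// !EFinM fineK.
pose K := n%:R `^ (n%:R / p) * expR (- (n%:R / p)) * v.
have K0 : 0 <= K by rewrite !mulr_ge0 ?powR_ge0 ?expR_ge0.
have sum_le : \sum_(j < J) expR (- (j%:R / p)) * (j.+1%:R `^ (n%:R / p) * v) <=
    J%:R * (expR 1 * K).
  apply: (@le_trans _ _ (\sum_(j < J) expR 1 * K)); last first.
    by rewrite sumr_const card_ord mulr_natl.
  apply: ler_sum => j _.
  have := @power_exp_max n j.+1%:R n0 (ltr0Sn _ _) => h.
  rewrite mulrA /K mulrA ler_wpM2r//.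
  apply: (@le_trans _ _
    (expR 1 * (j.+1%:R `^ (n%:R / p) * expR (- (j.+1%:R / p))))); last first.
    by rewrite ler_wpM2l ?expR_ge0.
  rewrite mulrCA mulrC ler_wpM2l ?powR_ge0// -expRD ler_expR -natr1 mulrDl.
  have : 1 / p <= 1 by rewrite ler_pdivrMr// mul1r.
  lra.
have step : base_mass ^+ n <= 2 * (p * (6 * n%:R + 3)) * (expR 1 * K).
  have : J%:R * (expR 1 * K) <= p * (6 * n%:R + 3) * (expR 1 * K).
    by rewrite ler_wpM2r// mulr_ge0 ?expR_ge0.
  by apply: arith; exact: le_trans shell (lerD sum_le half).
have vA : n%:R `^ (n%:R / p) * v <= fine (area p n n.+1%:R).
  rewrite -lee_fin EFinM fineK// fineK ?area_fin_num//.
  rewrite -(volume_scale p0) ?ltr0n//.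
  apply: le_trans (volume_le_area p n _).
  apply: le_measure; rewrite ?inE; [exact: measurable_simplex..|].
  move=> y [y0 yn]; split => //; apply: lt_trans yn _; by rewrite ltr_nat.
apply: le_trans (ler_wpM2r (expR_ge0 _) step) _.
have -> : 2 * (p * (6 * n%:R + 3)) * (expR 1 * K) * expR (n%:R / p) =
    2 * (p * (6 * n%:R + 3)) * expR 1 * (n%:R `^ (n%:R / p) * v) *
    (expR (n%:R / p) * expR (- (n%:R / p))) by rewrite /K; ring.
rewrite expRxMexpNx_1 mulr1.
have Q0 : 0 <= 2 * (p * (6 * n%:R + 3)) * expR 1 :> R.
  by rewrite !mulr_ge0 ?expR_ge0 ?(ltW p0)// addr_ge0 ?mulr_ge0.
apply: le_trans (ler_wpM2l Q0 vA) _; apply: ler_wpM2r; first exact/ltW/fine_area_gt0.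
apply: ler_wpM2r; first exact: expR_ge0.
by apply: ler_wpM2r; [rewrite mulr_ge0 ?(ltW p0)// addr_ge0 ?mulr_ge0|rewrite ler_nat].
Qed.
End volume_lower_bound.

(** * Upper bound: union over sets of coordinates *)
Section upper_bound.
Context {R : realType}.
Local Notation mR := (measurableTypeR R).
Local Notation leb n := (@lebesgue_tuple R n).
Variable p : R.
Hypothesis p1 : 1 <= p.
Local Notation psum := (power_sum p).
Local Notation simplex := (simplex p).
Local Notation density := (surface_density p).

Let p0 : 0 < p. Proof. exact: lt_le_trans p1. Qed.

Lemma quadrant_fun_powR n (y : n.-tuple R) : simplex n.+1%:R y ->
  quadrant_fun p y `^ p = n.+1%:R - psum y.
Proof.
move=> [_ yN]; rewrite /quadrant_fun -powRrM mulVf ?gt_eqF// powRr1//.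
by rewrite subr_ge0 ltW.
Qed.

Definition coordinate_powR n (y : n.-tuple R) (i : 'I_n.+1) : R :=
  tnth (graph_point (quadrant_fun p) y) i `^ p.

(** The coefficients of half the exponential rate on the coordinates in A: with them
exponent becomes sum_(i in A) v_i / (2p). *)
Definition subset_rate n (A : {set 'I_n.+1}) (i : nat) : R :=
  ((inord i : 'I_n.+1) \in A)%:R / (2 * p).

Lemma subset_rate_bound n (A : {set 'I_n.+1}) i :
  0 <= subset_rate A i <= (2 * p)^-1.
Proof.
have h : 0 <= (2 * p)^-1 by rewrite invr_ge0 mulr_ge0// ltW.
by rewrite /subset_rate; case: (_ \in A); rewrite ?mul1r ?mul0r lexx h.
Qed.

Lemma exponent_subset n (A : {set 'I_n.+1}) (y : n.-tuple R) : simplex n.+1%:R y ->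
  exponent p (subset_rate A) n.+1%:R y =
  (\sum_(i in A) coordinate_powR y i) / (2 * p).
Proof.
move=> ys; rewrite big_mkcond big_ord_recr/= mulrDl; congr (_ + _).
  rewrite mulr_suml; apply: eq_bigr => i _.
  rewrite /subset_rate /coordinate_powR.
  have -> : inord i = widen_ord (leqnSn n) i :> 'I_n.+1.
    by apply: val_inj; rewrite /= inordK// ltnS ltnW.
  rewrite (tnth_nth 0 (graph_point _ _)) /= nth_rcons size_tuple ltn_ord.
  by rewrite (tnth_nth 0 y); case: (_ \in A); rewrite ?mul1r ?mul0r// mulrC.
have -> : coordinate_powR y ord_max = n.+1%:R - psum y.
  rewrite /coordinate_powR (tnth_nth 0) /= nth_rcons size_tuple ltnn eqxx.
  exact: quadrant_fun_powR.
rewrite /subset_rate; have -> : inord n = ord_max :> 'I_n.+1.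
  by apply: val_inj; rewrite /= inordK.
by case: (_ \in A); rewrite ?mul1r ?mul0r// mulrC.
Qed.

Lemma prod_weight_mass_subset n (A : {set 'I_n.+1}) :
  (\prod_(i < n) weight_mass p (subset_rate A i - p^-1) <=
    (base_mass p ^+ n * expR (3 * #|A|%:R))%:E)%E.
Proof.
have half : (2 * p)^-1 - p^-1 = - (2 * p)^-1 by field; rewrite gt_eqF.
have h (i : 'I_n) : weight_mass p (subset_rate A i - p^-1) =
   (if (inord i : 'I_n.+1) \in A then tilted_mass p else base_mass p)%:E.
  rewrite /subset_rate; case: (_ \in A).
    by rewrite mul1r half tilted_massE.
  by rewrite mul0r add0r base_massE.
rewrite (eq_bigr _ (fun i _ => h i)) prodEFin lee_fin.
have m0 := base_mass_gt0 p1.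
apply: (@le_trans _ _
  (\prod_(i < n) (base_mass p * expR (3 * ((inord i : 'I_n.+1) \in A)%:R)))).
  apply: ler_prod => i _; case: (_ \in A).
    by rewrite tilted_mass_ge0//= mulr1 mulrC tilted_mass_le.
  by rewrite ltW//= mulr0 expR0 mulr1.
rewrite big_split/= prodr_const card_ord.
apply: ler_wpM2l; first by rewrite exprn_ge0// ltW.
rewrite -expR_sum ler_expR -mulr_sumr ler_wpM2l// -natr_sum ler_nat.
rewrite -sum1_card [leqRHS]big_mkcond/= big_ord_recr/=.
apply: leq_trans (leq_addr _ _); apply: leq_sum => i _.
have -> : inord i = widen_ord (leqnSn n) i :> 'I_n.+1.
  by apply: val_inj; rewrite /= inordK// ltnS ltnW.
by case: (_ \in A).
Qed.

(** The set A given by large_subset_sum contributes at least 1 to the sum; this is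
the union bound in the form of Chernoff's inequality. *)
Lemma quadrant_event_subset n (q t : R) (y : n.-tuple R) : p < q -> 0 < t ->
  \sum_(k < n.+1) (2 * (8 * p) * profile n.+1 k) `^ (q / p) <=
    (t `^ p / 2) `^ (q / p) * n.+1%:R ->
  simplex n.+1%:R y -> t < Lrn_norm q (graph_point (quadrant_fun p) y) ->
  1 <= \sum_(A : {set 'I_n.+1})
    expR (exponent p (subset_rate A) n.+1%:R y -
      (t `^ p * n.+1%:R `^ (p / q) / (8 * p) + 4 * \sum_(k < #|A|) profile n.+1 k)).
Proof.
move=> pq t0 hL ys tq.
have q0 : 0 < q by apply: lt_trans pq.
have [_ upos] := simplex_quadrant p0 ys.
move: tq; rewrite Lrn_norm_gt ?(ltW t0)//; last by move=> i; rewrite ltW.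
have powa (x : R) : x `^ q = (x `^ p) `^ (q / p).
  by rewrite -powRrM mulrCA mulfV ?gt_eqF// mulr1.
rewrite powa (eq_bigr (fun i => coordinate_powR y i `^ (q / p))); last first.
  by move=> i _; rewrite powa.
move=> tq.
have a1 : 1 <= q / p by rewrite ler_pdivlMr// mul1r ltW.
have X0 : 0 < t `^ p by rewrite powR_gt0.
have L0 : 0 <= 8 * p by rewrite mulr_ge0// ltW.
have v0 i : 0 <= coordinate_powR y i by exact: powR_ge0.
have [A A0 hA] := large_subset_sum a1 (ltn0Sn n) X0 L0 v0 hL tq.
rewrite (bigD1 A)//= -[leLHS]addr0; apply: lerD; last first.
  by apply: sumr_ge0 => B _; exact: expR_ge0.
rewrite -[leLHS]expR0 ler_expR subr_ge0 exponent_subset//.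
rewrite ler_pdivlMr ?mulr_gt0//; apply: le_trans (ltW hA).
rewrite invf_div le_eqVlt; apply/orP; left; apply/eqP.
by field; rewrite gt_eqF.
Qed.

Lemma profile_sum_ge (N m : nat) : (m <= N)%N ->
  m%:R <= \sum_(k < m) profile N k :> R.
Proof.
move=> mN; rewrite -[X in X%:R]card_ord -sumr_const; apply: ler_sum => k _.
by apply: profile_ge1; exact: leq_trans (ltn_ord k) mN.
Qed.

Definition polynomial_factor n : R :=
  (1 + n%:R * expR 3) * n.+2%:R * expR 2 * (4 * (p * (6 * n%:R + 3))).

(** By weighted_area_le a set A costs exp(3 |A|) for the tilted coordinates, and its
threshold gains exp(-4 sum_(k < |A|) profile). Since profile is at least 1, one
of the four copies is left for sum_subsets_profile_le. *)
Lemma quadrant_tail_le_factor n (q t : R) : (0 < n)%N -> p < q -> 0 < t ->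
  \sum_(k < n.+1) (2 * (8 * p) * profile n.+1 k) `^ (q / p) <=
    (t `^ p / 2) `^ (q / p) * n.+1%:R ->
  quadrant_tail n p q t <=
  polynomial_factor n * expR (- (t `^ p * n.+1%:R `^ (p / q) / (8 * p))).
Proof.
move=> n0 pq t0 hL; apply: quadrant_measure_le => //.
rewrite graph_area_quadrantE//.
set s := t `^ p * n.+1%:R `^ (p / q) / (8 * p).
pose r (A : {set 'I_n.+1}) := s + 4 * \sum_(k < #|A|) profile n.+1 k.
pose e (A : {set 'I_n.+1}) (y : n.-tuple mR) : R :=
  expR (exponent p (subset_rate A) n.+1%:R y) * density n.+1%:R y.
have e0 A y : 0 <= e A y by rewrite mulr_ge0 ?expR_ge0 ?surface_density_ge0.
have me A : measurable_fun setT (fun y => (e A y)%:E).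
  apply/measurable_EFinP; apply: measurable_funM.
    by apply: (measurableT_comp (@measurable_expR R)); exact: measurable_exponent.
  exact: measurable_surface_density.
have mS := @measurable_simplex R p n n.+1%:R.
apply: (@le_trans _ _ (\int[leb n]_(y in simplex n.+1%:R)
    (\sum_(A : {set 'I_n.+1}) (expR (- r A))%:E * (e A y)%:E))%E).
  apply: nonneg_le_integral_dom => y.
  - by move=> _; rewrite lee_fin surface_density_ge0.
  - by move=> _; apply: sume_ge0 => A _; rewrite -EFinM lee_fin mulr_ge0 ?expR_ge0.
  - move=> [ys /= [_ ty]] _.
    rewrite (eq_bigr (fun A => (expR (- r A) * e A y)%:E)); last first.
      by move=> A _; rewrite EFinM.
    rewrite sumEFin lee_fin -[leLHS]mul1r.
    apply: le_trans (ler_wpM2r (surface_density_ge0 _ _ _)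
      (quadrant_event_subset pq t0 hL ys ty)) _.
    rewrite mulr_suml le_eqVlt; apply/orP; left; apply/eqP.
    by apply: eq_bigr => A _; rewrite /e mulrA -expRD addrC.
  - by move=> [].
rewrite ge0_integral_sum//; last 2 first.
- by move=> A; apply: measurable_funeM; apply: measurable_funTS.
- by move=> A y _; rewrite -EFinM lee_fin mulr_ge0 ?expR_ge0.
pose B : R := (1 + n%:R * expR 3) * expR (n.+1%:R / p) * base_mass p ^+ n.
have b0 : 0 <= 1 + n%:R * expR 3 :> R.
  by apply: addr_ge0 => //; apply: mulr_ge0 => //; exact: expR_ge0.
have B0 : 0 <= B.
  apply: mulr_ge0; first by apply: mulr_ge0 => //; exact: expR_ge0.
  by apply: exprn_ge0; apply: ltW; exact: base_mass_gt0.
have termA A : (\int[leb n]_(y in simplex n.+1%:R) ((expR (- r A))%:E * (e A y)%:E) <=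
    (B * expR (- s) * expR (- \sum_(k < #|A|) profile n.+1 k))%:E)%E.
  have eA (y : n.-tuple mR) : simplex n.+1%:R y -> (0 <= (e A y)%:E)%E.
    by move=> _; rewrite lee_fin.
  rewrite (ge0_integralZl_EFin _ mS eA (measurable_funTS (me A)) (expR_ge0 _)).
  have h := @weighted_area_le R p p1 n (subset_rate A) n.+1%:R (subset_rate_bound A).
  apply: le_trans (lee_wpmul2l _ h) _; first by rewrite lee_fin expR_ge0.
  apply: le_trans (lee_wpmul2l _ (lee_wpmul2l _ (prod_weight_mass_subset A))) _.
  - by rewrite lee_fin expR_ge0.
  - by rewrite lee_fin; apply: mulr_ge0 => //; exact: expR_ge0.
  rewrite -!EFinM lee_fin.
  rewrite [leLHS](_ : _ = B * (expR (- r A) * expR (3 * #|A|%:R))); last first.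
    by rewrite /B; ring.
  rewrite -mulrA ler_wpM2l// -!expRD ler_expR /r.
  have := @profile_sum_ge n.+1 #|A|.
  rewrite -[X in (_ <= X)%N -> _]card_ord max_card => /(_ isT).
  by lra.
apply: (@le_trans _ _ (\sum_(A : {set 'I_n.+1})
    (B * expR (- s) * expR (- \sum_(k < #|A|) profile n.+1 k))%:E)%E).
  by apply: lee_sum => A _; exact: termA.
rewrite sumEFin lee_fin -mulr_sumr.
apply: le_trans (ler_wpM2l _ (sum_subsets_profile_le n.+1)) _.
  by rewrite mulr_ge0 ?expR_ge0.
have h := mass_le_area p1 n0.
have c0 : 0 <= (1 + n%:R * expR 3) * n.+2%:R * expR (- s) * expR p^-1.
  by rewrite !mulr_ge0 ?expR_ge0.
have {}h := ler_wpM2l c0 h.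
rewrite [leLHS](_ : _ = (1 + n%:R * expR 3) * n.+2%:R * expR (- s) * expR p^-1 *
  (base_mass p ^+ n * expR (n%:R / p))); last first.
  rewrite /B (_ : n.+1%:R / p = p^-1 + n%:R / p); last by rewrite -natr1; ring.
  by rewrite (expRD p^-1); ring.
apply: le_trans h _.
set F := fine _; have F0 : 0 <= F by exact/ltW/fine_area_gt0.
have e2 : expR 2 = expR 1 * expR 1 :> R by rewrite -expRD.
have ep : expR p^-1 <= expR 1 by rewrite ler_expR invf_le1.
have -> : polynomial_factor n * expR (- s) * F =
  (1 + n%:R * expR 3) * n.+2%:R * expR (- s) * (4 * (p * (6 * n%:R + 3))) * F *
    expR 1 * expR 1.
  by rewrite /polynomial_factor e2; ring.
rewrite [leLHS](_ : _ =
  (1 + n%:R * expR 3) * n.+2%:R * expR (- s) * (4 * (p * (6 * n%:R + 3))) * F *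
    expR 1 * expR p^-1); last by ring.
apply: ler_wpM2l => //.
have pn : 0 <= p * (6 * n%:R + 3) by apply: mulr_ge0; [exact: ltW|exact: addr_ge0].
by do ?[exact: expR_ge0|exact: pn|exact: b0|apply: mulr_ge0].
Qed.
End upper_bound.

(** * Universal constants *)
Section main.
Context {R : realType}.
Implicit Types p q t : R.

Lemma ln_ge_half n : (0 < n)%N -> 2^-1 <= ln n.+1%:R :> R.
Proof.
move=> n0; rewrite -[leLHS]expRK ler_ln ?posrE ?expR_gt0//.
by apply: le_trans expR_half_le2 _; rewrite ler_nat ltnS.
Qed.

Lemma expR1_ge2 : 2 <= expR 1 :> R.
Proof. by apply: le_trans (expR_ge1Dx _); lra. Qed.

Lemma expR_nat_ge k : 2 ^+ k <= expR k%:R :> R.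
Proof.
rewrite -[k%:R]mul1r expRM_natr lerXn2r ?nnegrE ?expR_ge0//; exact: expR1_ge2.
Qed.

Lemma polynomial_factor_le p n : 1 <= p -> (0 < n)%N ->
  polynomial_factor p n <= expR (27 * p * ln n.+1%:R).
Proof.
move=> p1 n0; have l2 := ln_ge_half n0; set l := ln n.+1%:R in l2 *.
have Nl : n.+1%:R = expR l by rewrite lnK// posrE.
have nE : n%:R = expR l - 1 :> R by rewrite -Nl -natr1 addrK.
have l1 : 1 <= expR l by rewrite -Nl ler1n.
have e3 : 8 <= expR 3 :> R by apply: le_trans (expR_nat_ge 3); rewrite -natrX.
have e2 : 4 <= expR 2 :> R by apply: le_trans (expR_nat_ge 2); rewrite -natrX.
have e1 := expR1_ge2.
have h1 : 1 + n%:R * expR 3 <= expR (l + 3).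
  rewrite nE expRD mulrBl mul1r; lra.
have h2 : n.+2%:R <= expR (l + 1).
  rewrite -natr1 Nl expRD.
  have : expR l * 2 <= expR l * expR 1 by rewrite ler_wpM2l ?expR_ge0.
  lra.
have h3 : 6 * n%:R + 3 <= expR (l + 3).
  rewrite nE expRD.
  have : expR l * 8 <= expR l * expR 3 by rewrite ler_wpM2l ?expR_ge0.
  lra.
have hp : p <= expR p by apply: le_trans (expR_ge1Dx _); lra.
have p0 : 0 <= p by lra.
have n00 : 0 <= n%:R :> R by [].
have b0 : 0 <= 1 + n%:R * expR 3 :> R.
  by apply: addr_ge0 => //; apply: mulr_ge0 => //; exact: expR_ge0.
have c0 : 0 <= 6 * n%:R + 3 :> R by lra.
apply: (@le_trans _ _
  (expR (l + 3) * expR (l + 1) * expR 2 * (expR 2 * (expR p * expR (l + 3))))).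
  by rewrite /polynomial_factor; do ?[exact: expR_ge0|assumption|exact: lexx|
    apply: mulr_ge0|apply: ler_pM].
rewrite -!expRD ler_expR.
have : 1 * l <= p * l by rewrite ler_wpM2r//; lra.
have : p * 2^-1 <= p * l by rewrite ler_wpM2l.
lra.
Qed.

(** Chooses the constant in T: powers of it beat the quadratic in p that the
polynomial factors require. *)
Lemma tau_powR_ge p : 1 <= p -> 500 * p ^+ 2 <= (2 * 20 ^+ 3) `^ p :> R.
Proof.
move=> p1; have p0 : 0 <= p by lra.
have c0 : 0 <= 20 ^+ 3 :> R by rewrite exprn_ge0.
rewrite powRM//.
have h1 := powR2_ge_sqr p0.
have h2 : 20 ^+ 3 <= (20 ^+ 3) `^ p :> R.
  by rewrite -[leLHS]powRr1// ler_powR// exprn_ege1// ler1n.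
apply: (@le_trans _ _ (p ^+ 2 / 16 * 20 ^+ 3)).
  by rewrite le_eqVlt; apply/orP; left; apply/eqP; field.
by apply: ler_pM => //; rewrite divr_ge0 ?sqr_ge0.
Qed.

(** The threshold serves twice. Either term of the minimum makes the sum of powers
of the profile small, as quadrant_tail_le_factor requires, and it makes
s = t^p N^(p/q) at least 500 p^2 log N, so that the polynomial factor is at most
exp(s/(16p)). *)
Theorem quadrant_tail_le n p q t : (0 < n)%N -> 1 <= p -> p < q ->
  (2 * 20 ^+ 3) * Num.min q (ln n.+1%:R) `^ p^-1 < t ->
  quadrant_tail n p q t <= expR (- (16^-1 / p * t `^ p * n.+1%:R `^ (p / q))).
Proof.
move=> n0 p1 pq; have l2 := ln_ge_half n0; set l := ln n.+1%:R in l2 *.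
set m := Num.min q l => tT.
have p0 : 0 < p by lra.
have q0 : 0 < q by lra.
have m0 : 0 < m by rewrite lt_min q0; lra.
have T0 : 0 <= (2 * 20 ^+ 3) * m `^ p^-1 by rewrite mulr_ge0 ?powR_ge0.
have t0 : 0 < t by apply: le_lt_trans tT.
have a1 : 1 <= q / p by rewrite ler_pdivlMr// mul1r ltW.
have a0 : 0 < q / p by lra.
have X0 : 0 < t `^ p by rewrite powR_gt0.
have p2 : p <= p ^+ 2 by rewrite expr2 ler_peMl// ltW.
have Xm : 500 * p ^+ 2 * m <= t `^ p.
  have : ((2 * 20 ^+ 3) * m `^ p^-1) `^ p <= t `^ p.
    by rewrite ge0_ler_powR ?nnegrE ?(ltW p0) ?(ltW t0) ?(ltW tT).
  rewrite powRM ?powR_ge0// -powRrM mulVf ?gt_eqF// powRr1 ?(ltW m0)//.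
  by apply: le_trans; rewrite ler_wpM2r ?(ltW m0)// tau_powR_ge.
have N1 : 1 <= n.+1%:R `^ (p / q) :> R.
  by rewrite -[leLHS](powRr0 n.+1%:R) ler_powR ?ler1n// divr_ge0// ltW.
have NE : n.+1%:R `^ (p / q) = expR (p / q * l) :> R.
  by rewrite /powR gt_eqF.
have sl : 500 * p ^+ 2 * l <= t `^ p * n.+1%:R `^ (p / q).
  apply: (@le_trans _ _ (500 * p ^+ 2 * (m * n.+1%:R `^ (p / q)))); last first.
    by rewrite mulrA ler_wpM2r// powR_ge0.
  apply: ler_wpM2l; first by rewrite mulr_ge0 ?ler0n ?sqr_ge0.
  rewrite /m; have [ql|lq] := leP q l; last by rewrite ler_peMr//; lra.
  (* Here N^(p/q) >= 1 + (p/q) log N makes up for the smaller q. *)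
  apply: (@le_trans _ _ (q * (p / q * l))).
    rewrite mulrA mulrCA mulfV ?gt_eqF// mulr1.
    by rewrite ler_peMl//; lra.
  rewrite ler_wpM2l ?(ltW q0)// NE; apply: le_trans (expR_ge1Dx _); lra.
have hL : \sum_(k < n.+1) (2 * (8 * p) * profile n.+1 k) `^ (q / p) <=
    (t `^ p / 2) `^ (q / p) * n.+1%:R.
  have c0 : 0 <= 2 * (8 * p) by lra.
  rewrite (eq_bigr (fun k : 'I_n.+1 =>
    (2 * (8 * p)) `^ (q / p) * profile n.+1 k `^ (q / p))); last first.
    by move=> k _; rewrite powRM// profile_ge0.
  rewrite -mulr_sumr.
  (* B stands for 8q/p or for 1 + log N, according to the minimum. *)
  have [B BX hB] : exists2 B, 2 * (8 * p) * B <= t `^ p / 2 & 0 <= B /\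
      \sum_(k < n.+1) profile n.+1 k `^ (q / p) <= B `^ (q / p) * n.+1%:R :> R.
    move: Xm; rewrite /m; have [ql|lq] := leP q l => Xm.
      exists (8 * (q / p)); last first.
        by split; [apply: mulr_ge0 => //; exact: ltW|exact: sum_profile_powR_le].
      rewrite (_ : 2 * (8 * p) * (8 * (q / p)) = 128 * q); last by field; rewrite gt_eqF.
      have : 500 * q <= 500 * p ^+ 2 * q by rewrite ler_wpM2r ?(ltW q0)//; lra.
      lra.
    exists (1 + l); last first.
      by split; [lra|apply: sum_profile_log_le; exact: ltW].
    have : 500 * p * l <= 500 * p ^+ 2 * l by rewrite ler_wpM2r//; lra.
    have : p * 2^-1 <= p * l by rewrite ler_wpM2l// ltW.
    lra.
  have [B0 {}hB] := hB.
  apply: le_trans (ler_wpM2l (powR_ge0 _ _) hB) _.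
  rewrite [leLHS]mulrA -powRM//; apply: ler_wpM2r => //.
  rewrite ge0_ler_powR ?nnegrE ?(ltW a0)//; first by rewrite mulr_ge0.
  by rewrite divr_ge0// ltW.
apply: le_trans (quadrant_tail_le_factor p1 n0 pq t0 hL) _.
apply: le_trans (ler_wpM2r (expR_ge0 _) (polynomial_factor_le p1 n0)) _.
rewrite -expRD ler_expR -/l.
have -> : 16^-1 / p * t `^ p * n.+1%:R `^ (p / q) = t `^ p * n.+1%:R `^ (p / q) / (16 * p).
  by field; rewrite gt_eqF.
move: sl; set s := t `^ p * _ => sl.
have -> : s / (8 * p) = s / (16 * p) + s / (16 * p) by field; rewrite gt_eqF.
suff : 27 * p * l <= s / (16 * p) by lra.
rewrite ler_pdivlMr ?mulr_gt0//; apply: le_trans sl.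
rewrite (_ : 27 * p * l * (16 * p) = 432 * p ^+ 2 * l); last by ring.
have : 0 <= p ^+ 2 * l by rewrite mulr_ge0 ?sqr_ge0//; lra.
lra.
Qed.

(** The quadrant is reduced to the point 1, of norm 1. *)
Lemma quadrant_tail_dim1 p q t (a : R) : 1 <= p -> p < q -> 1 < t -> 0 <= a ->
  quadrant_tail 0 p q t <= a.
Proof.
move=> p1 pq t1 a0; have p0 : 0 < p by lra.
have q0 : 0 < q by lra.
apply: quadrant_measure_le => //.
rewrite graph_area_quadrantE// [X in (\int[_]_(y in X) _)%E](_ : _ = set0); last first.
  apply/seteqP; split => // y [ys /= [_]].
  have [_ upos] := simplex_quadrant p0 ys.
  rewrite Lrn_norm_gt//; [|lra|by move=> i; exact: ltW].
  rewrite (sum_graph_point (fun x => x `^ q)) big_ord0 add0r mulr1.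
  have := quadrant_fun_powR p1 ys; rewrite /power_sum big_ord0 subr0 => h.
  rewrite [X in _ < X](_ : _ = (quadrant_fun p y `^ p) `^ (q / p)); last first.
    by rewrite -powRrM mulrCA mulfV ?gt_eqF// mulr1.
  rewrite h powR1 ltNge => /negP; apply.
  by rewrite -[leLHS](powRr0 t) ler_powR// ltW.
rewrite integral_set0 lee_fin mulr_ge0//; exact/ltW/fine_area_gt0.
Qed.
End main.

(* The dimension of the ambient space is n.+1; [2 <= n.+1] in the second part. *)
Theorem theorem3 (R : realType) :
  (forall p q : R, 1 <= p -> p < q ->
    exists c C T : R, [/\ 0 < c, 0 < C, 0 < T &
      forall n : nat,
        (forall t : R, T < t ->
          quadrant_tail n p q t <= expR (- (c * t `^ p * n.+1%:R `^ (p / q)))) /\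
        (forall t : R, 2 <= t -> t <= 2^-1 * n.+1%:R `^ (p^-1 - q^-1) ->
          expR (- (C * t `^ p * n.+1%:R `^ (p / q))) <= quadrant_tail n p q t)])
  /\
  (forall lam : R, 0 < lam ->
    exists gamma Gamma tau : R, [/\ 0 < gamma, 0 < Gamma, 0 < tau &
      forall p q : R, 1 <= p -> p < q -> lam * p < q ->
      forall n : nat, (2 <= n.+1)%N ->
        let c := gamma / p in
        let C := Gamma / p in
        let T := tau * Num.min q (ln n.+1%:R) `^ p^-1 in
        [/\ T <= tau * q `^ p^-1,
          (forall t : R, T < t ->
            quadrant_tail n p q t <= expR (- (c * t `^ p * n.+1%:R `^ (p / q)))) &
          (forall t : R, 2 <= t -> t <= 2^-1 * n.+1%:R `^ (p^-1 - q^-1) ->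
            expR (- (C * t `^ p * n.+1%:R `^ (p / q))) <= quadrant_tail n p q t)]]).
Proof.
have threshold_le (p q : R) n : 1 <= p -> p < q -> (0 < n)%N ->
    (2 * 20 ^+ 3) * Num.min q (ln n.+1%:R) `^ p^-1 <= (2 * 20 ^+ 3) * q `^ p^-1.
  move=> p1 pq n0; have l2 := ln_ge_half (R := R) n0.
  apply: ler_wpM2l => //; rewrite ge0_ler_powR ?nnegrE ?invr_ge0 ?ge_min ?lexx//; try lra.
  by rewrite le_min; apply/andP; split; lra.
split=> [p q p1 pq|lam _].
  have p0 : 0 < p by lra.
  have q1 : 1 <= q `^ p^-1.
    by rewrite -[leLHS](powRr0 q) ler_powR ?invr_ge0//; lra.
  exists (16^-1 / p), (260 / p), ((2 * 20 ^+ 3) * q `^ p^-1).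
  split=> [|||n].
  - by rewrite divr_gt0 ?invr_gt0 ?ltr0n.
  - by rewrite divr_gt0 ?ltr0n.
  - by rewrite !mulr_gt0 ?exprn_gt0 ?ltr0n ?powR_gt0//; lra.
  split=> t; last by move=> t2; exact: quadrant_tail_ge.
  case: n => [|n] tT; first by apply: quadrant_tail_dim1; rewrite ?expR_ge0//; lra.
  by apply: quadrant_tail_le => //; exact: le_lt_trans (threshold_le _ _ _ p1 pq _) tT.
exists 16^-1, 260, (2 * 20 ^+ 3); split.
- by rewrite invr_gt0 ltr0n.
- by rewrite ltr0n.
- by rewrite mulr_gt0 ?exprn_gt0 ?ltr0n.
move=> p q p1 pq _ n n0 /=; split.
- exact: threshold_le.
- by move=> t tT; exact: quadrant_tail_le.
- by move=> t t2; exact: quadrant_tail_ge.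
Qed.
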